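(* Let $L,L'\subseteq\{0,1\}^*$ be languages and let $e_s,e_c\in[0,1]$ be constants. Let $t=t(n)>0$ be a polynomial and $\epsilon>0$. Let $A\colon\binom{\{0,1\}^n}{\le t}\to\{0,1\}^{\epsilon t}$ be a randomized $\mathsf{P/poly}$-algorithm such that for all $x\in\binom{\{0,1\}^n}{\le t}$: if $|x\cap L|=0$, then $A(x)\notin L'$ with probability at least $1-e_s$; and if $|x\cap L|=1$, then $A(x)\in L'$ with probability at least $1-e_c$. If $e_s+e_c<1-\sqrt{(2\ln 2)\,\epsilon}$, then $L\in\mathsf{NP/poly}\cap\mathsf{coNP/poly}$.
   Context: $\binom{V}{\le t}$ denotes the set of all subsets of $V$ of size at most $t$. A randomized $\mathsf{P/poly}$-algorithm is given, for each input length $n$, by a polynomial-size circuit that additionally receives uniformly random bits as its internal randomness; probabilities are over these bits. $\mathsf{NP/poly}$ and $\mathsf{coNP/poly}$ are the non-uniform versions of $\mathsf{NP}$ and $\mathsf{coNP}$. *)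

(* Defs.v *)
From mathcomp Require Import all_boot all_order all_algebra.
From mathcomp Require Import all_classical all_reals all_analysis.

Set Implicit Arguments.
Unset Strict Implicit.
Unset Printing Implicit Defensive.

Import Order.TTheory GRing.Theory Num.Theory.

Local Open Scope classical_set_scope.
Local Open Scope ring_scope.

Definition language : Type := set (seq bool).

(* Rational coefficients are fully general here: by interpolation, a real
   polynomial taking natural values on the naturals has rational coefficients. *)
Definition is_polynomial (f : nat -> nat) : Prop :=
  exists p : {poly rat}, forall n : nat, (f n)%:R = p.[n%:R].

Definition poly_bounded (f : nat -> nat) : Prop :=
  exists p : {poly nat}, forall n : nat, (f n <= p.[n])%N.

(* Boolean circuits are DAGs in topological order: with [n] inputs, wires
   0, ..., n-1 are the inputs and wire n + k is the output of the k-th gate,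
   which may only read wires of smaller index.  Fan-out is unbounded. *)
Variant gate : Type :=
  | GConst of bool
  | GNot of nat
  | GAnd of nat & nat
  | GOr of nat & nat.

Definition gate_wf (w : nat) (g : gate) : bool :=
  match g with
  | GConst _ => true
  | GNot i => (i < w)%N
  | GAnd i j | GOr i j => (i < w)%N && (j < w)%N
  end.

Fixpoint gates_wf (w : nat) (gs : seq gate) : bool :=
  if gs is g :: gs' then gate_wf w g && gates_wf w.+1 gs' else true.

Record circuit (n m : nat) : Type := Circuit {
  gates : seq gate;
  outputs : m.-tuple nat;
  gates_wfP : gates_wf n gates;
  outputs_wfP : all (fun i => (i < n + size gates)%N) outputs
}.

Definition circuit_size (n m : nat) (C : circuit n m) : nat :=
  (n + size (gates C) + m)%N.

Definition eval_gate (w : seq bool) (g : gate) : bool :=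
  match g with
  | GConst b => b
  | GNot i => ~~ nth false w i
  | GAnd i j => nth false w i && nth false w j
  | GOr i j => nth false w i || nth false w j
  end.

Definition wires (gs : seq gate) (x : seq bool) : seq bool :=
  foldl (fun w g => rcons w (eval_gate w g)) x gs.

Definition eval (n m : nat) (C : circuit n m) (x : n.-tuple bool) :
    m.-tuple bool :=
  [tuple of map (nth false (wires (gates C) x)) (outputs C)].

(* The last [rbits] inputs are the internal random bits. *)
Record rcircuit (n m : nat) : Type := RCircuit {
  rbits : nat;
  rbody : circuit (n + rbits) m
}.

Definition prob (R : realType) (n m : nat) (C : rcircuit n m)
    (x : n.-tuple bool) (E : language) : R :=
  #|[pred r : (rbits C).-tuple bool |
      tval (eval (rbody C) [tuple of x ++ r]) \in E]|%:R / 2 ^+ rbits C.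

Definition lex_le (n : nat) (u v : n.-tuple bool) : bool :=
  @Order.le _ (seqlexi bool) (tval u) (tval v).

(* A set of at most [t] strings of length [n] is fed to a circuit as [t] slots
   of [n.+1] bits: the elements in lexicographic order, each preceded by the
   bit [true], followed by all-[false] slots.  Each set thus has exactly one
   encoding. *)
Definition encode_set (t n : nat) (x : {set n.-tuple bool}) :
    (t * n.+1).-tuple bool :=
  [tuple nth false
    (flatten [seq true :: tval v | v <- sort (@lex_le n) (enum x)]) i
    | i < t * n.+1].

Definition poly_size (a b : nat -> nat) (A : forall n, rcircuit (a n) (b n)) :
    Prop :=
  poly_bounded (fun n => circuit_size (rbody (A n))).

(* Non-uniform NP: certificates of polynomial length, verified by
   polynomial-size circuits. *)
Definition NPpoly : set language := [set L : language |
  exists (w : nat -> nat) (V : forall n, circuit (n + w n) 1),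
    poly_bounded (fun n => circuit_size (V n)) /\
    forall (n : nat) (x : n.-tuple bool),
      L (tval x) <->
      exists y : (w n).-tuple bool, thead (eval (V n) [tuple of x ++ y])].

Definition coNPpoly : set language := [set L : language | NPpoly (~` L)].

(* Main.v *)
(* Fix an input length n and let N be the set of its no-instances.  For v0 in N,
   a vector b of t points and a position i, replace b_i by the input v and feed A
   with the set { w_j ? b_j : v0 } for uniformly random bits w_j.  Let I(v) be the
   mutual information between w_i and the output of A.

   If b is uniform in N^t, the informations of the t independent bits w_j sum up
   to at most the output length, so I(v) is at most eps bits on average over v in
   N; by Markov's inequality a constant fraction of N has I(v) <= beta for a
   beta slightly larger, and iterating on the rest gives O(n) triples (v0, b, i),
   the cores, such that each no-instance v has I(v) <= beta for one of them.
   If v is a yes-instance then the output predicts w_i through L' with advantage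
   D close to 1 - e_s - e_c, so by a Pinsker-type bound I(v) >= D^2/2 nats for
   every core.  The hypothesis says exactly that eps ln 2 < D^2/2 is possible.

   It remains to certify, with polynomial-size non-uniform verifiers, lower and
   upper bounds on I(v).  With C the sampling circuit, I(v) is ln 2 plus the
   difference of the mean log-fibre sizes of (w_i, C) and of C.  After passing to
   a k-fold product, fibre sizes concentrate, and both directions are tested by
   exhibiting a preimage on which affine hash functions vanish (as in the
   Goldwasser-Sipser set lower bound); the hash functions err on fewer than a
   2^-n fraction of the choices for each v and can therefore be fixed as advice. *)

Require Import Defs.
From mathcomp Require Import all_boot all_order all_algebra.
From mathcomp Require Import all_classical all_reals all_analysis.
From mathcomp Require Import zify ring lra.

Set Implicit Arguments.
Unset Strict Implicit.
Unset Printing Implicit Defensive.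

Import Order.TTheory GRing.Theory Num.Theory.
Import numFieldNormedType.Exports.

(** * Formulas, circuits and projections of formulas *)

Local Open Scope nat_scope.

(** All points of a core are no-instances. Hence, for a yes-instance [v], the set fed to [A] meets
    [L] in at most [v], and does so exactly when [w_i] is set, so one of the two promises always
    applies. Repeated points do no harm, as the set merely shrinks. The information is a difference
    of two mean log-fibre sizes, and each of these can only be certified to be small or to be large.
    A verifier therefore guesses a multiple of [g] close to one of them and bounds the two in
    opposite directions. The grid and the two tests lose [g] each, and the gap between [beta] and
    D^2/2 absorbs [3 * g]. Exchanging the directions turns the verifier for [L], which checks all
    cores, into the one for the complement, which needs a single core. Verifiers are built as
    existential projections of small formulas: guessed wire values express a circuit of unbounded
    fan-out in linear size, and a guessed encoding of a set replaces sorting. Exclusive or is a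
    basic connective because the affine hashes are sums modulo 2. *)

Inductive form (V : Type) : Type :=
  | FVar of V
  | FConst of bool
  | FAnd of form V & form V
  | FXor of form V & form V.

Arguments FConst {V} b.

Fixpoint fsize (V : Type) (f : form V) : nat :=
  match f with
  | FVar _ | FConst _ => 1
  | FAnd a b | FXor a b => (fsize a + fsize b).+1
  end.

Fixpoint feval (V : Type) (e : V -> bool) (f : form V) : bool :=
  match f with
  | FVar v => e v
  | FConst b => b
  | FAnd a b => feval e a && feval e b
  | FXor a b => feval e a (+) feval e b
  end.

Fixpoint frename (V V' : Type) (r : V -> V') (f : form V) : form V' :=
  match f with
  | FVar v => FVar (r v)
  | FConst b => FConst b
  | FAnd a b => FAnd (frename r a) (frename r b)
  | FXor a b => FXor (frename r a) (frename r b)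
  end.

Definition FNot V (f : form V) := FXor f (FConst true).
Definition FOr V (f g : form V) := FNot (FAnd (FNot f) (FNot g)).

Lemma fsize_rename V V' (r : V -> V') f : fsize (frename r f) = fsize f.
Proof. by elim: f => //= a -> b ->. Qed.

Lemma feval_rename V V' (r : V -> V') e f :
  feval e (frename r f) = feval (e \o r) f.
Proof. by elim: f => //= a -> b ->. Qed.

Lemma feval_ext V (e e' : V -> bool) f : e =1 e' -> feval e f = feval e' f.
Proof. by move=> ee'; elim: f => //= a -> b ->. Qed.

Lemma feval_imp V (e e' : V -> bool) f : e =1 e' -> feval e f -> feval e' f.
Proof. by move=> /feval_ext ->. Qed.

Lemma feval_not V (e : V -> bool) f : feval e (FNot f) = ~~ feval e f.
Proof. by rewrite /= addbT. Qed.

Lemma feval_or V (e : V -> bool) f g :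
  feval e (FOr f g) = feval e f || feval e g.
Proof. by rewrite /FOr feval_not /= !addbT -negb_or negbK. Qed.

(** * Compiling formulas into circuits *)

Lemma wires_cat gs gs' x : wires (gs ++ gs') x = wires gs' (wires gs x).
Proof. by rewrite /wires foldl_cat. Qed.

Lemma wires_rcons gs g x :
  wires (rcons gs g) x = rcons (wires gs x) (eval_gate (wires gs x) g).
Proof. by rewrite -cats1 wires_cat. Qed.

Lemma size_wires gs x : size (wires gs x) = size x + size gs.
Proof.
elim/last_ind: gs => [|gs g IH]; first by rewrite addn0.
by rewrite wires_rcons !size_rcons IH addnS.
Qed.

Lemma nth_wires_cat gs gs' x i : i < size x + size gs ->
  nth false (wires (gs ++ gs') x) i = nth false (wires gs x) i.
Proof.
move=> lti; elim/last_ind: gs' => [|gs' g IH]; first by rewrite cats0.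
rewrite -rcons_cat wires_rcons nth_rcons size_wires size_cat addnA.
by rewrite (leq_trans lti (leq_addr _ _)).
Qed.

Lemma gates_wf_cat n gs gs' :
  gates_wf n (gs ++ gs') = gates_wf n gs && gates_wf (n + size gs) gs'.
Proof.
elim: gs n => [|g gs IH] n /=; first by rewrite addn0.
by rewrite IH addSnnS andbA.
Qed.

Lemma gates_wf_rcons n gs g :
  gates_wf n (rcons gs g) = gates_wf n gs && gate_wf (n + size gs) g.
Proof. by rewrite -cats1 gates_wf_cat /= andbT. Qed.

Definition computes n (gs : seq gate) i (h : seq bool -> bool) :=
  [/\ gates_wf n gs, i < n + size gs &
      forall x, size x = n -> nth false (wires gs x) i = h x].

Lemma computes_cat n gs gs' i h :
  computes n gs i h -> gates_wf n (gs ++ gs') -> computes n (gs ++ gs') i h.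
Proof.
move=> [wf lti hi] wf'; split=> //.
  by rewrite size_cat addnA (leq_trans lti (leq_addr _ _)).
by move=> x sx; rewrite nth_wires_cat ?hi // sx.
Qed.

Lemma computes_gate n gs g h : gates_wf n gs -> gate_wf (n + size gs) g ->
  (forall x, size x = n -> eval_gate (wires gs x) g = h x) ->
  computes n (rcons gs g) (n + size gs) h.
Proof.
move=> wf wg hg; split.
- by rewrite gates_wf_rcons wf.
- by rewrite size_rcons addnS.
- by move=> x sx; rewrite wires_rcons nth_rcons size_wires sx ltnn eqxx hg.
Qed.

(** The induction extends an arbitrary gate list, since the second operand is compiled after the
    first and must not disturb its wires. An exclusive or takes four gates, (f or g) and not (f and
    g), whence the factor 4. *)
Lemma compile n (f : form 'I_n) gs : gates_wf n gs ->
  exists gs' i, size gs' <= 4 * fsize f /\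
    computes n (gs ++ gs') i (fun x => feval (fun j : 'I_n => nth false x j) f).
Proof.
elim: f gs => [v|b|f IHf g IHg|f IHf g IHg] gs wf.
- exists [::], (val v); split=> //; rewrite cats0; split=> //.
    by rewrite (leq_trans (ltn_ord v)) // leq_addr.
  move=> x sx; rewrite -(cat0s gs) nth_wires_cat //= addn0 sx; exact: ltn_ord.
- exists [:: GConst b], (n + size gs); split=> //; rewrite cats1.
  exact: computes_gate.
- have [gs1 [i1 [s1 c1]]] := IHf _ wf; have [wf1 _ _] := c1.
  have [gs2 [i2 [s2 c2]]] := IHg _ wf1; have [wf2 lt2 h2] := c2.
  have [_ lt1 h1] := computes_cat c1 wf2.
  exists (rcons (gs1 ++ gs2) (GAnd i1 i2)), (n + size ((gs ++ gs1) ++ gs2)).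
  split; first by rewrite size_rcons size_cat /= mulnS mulnDr; lia.
  rewrite -rcons_cat catA; apply: computes_gate => //=; first by rewrite lt1.
  by move=> x sx; rewrite h1 // h2.
- have [gs1 [i1 [s1 c1]]] := IHf _ wf; have [wf1 _ _] := c1.
  have [gs2 [i2 [s2 c2]]] := IHg _ wf1; have [wf2 lt2 h2] := c2.
  have [_ lt1 h1] := computes_cat c1 wf2.
  set G := (gs ++ gs1) ++ gs2.
  have cOr := @computes_gate n G (GOr i1 i2)
    (fun x => feval (fun j : 'I_n => nth false x j) f
           || feval (fun j : 'I_n => nth false x j) g) wf2.
  have {cOr} [|x sx|wf3 lt3 h3] := cOr; first by rewrite /= lt1.
    by rewrite /= h1 // h2.
  set G3 := rcons G _ in wf3 lt3 h3.
  have wf3' : gates_wf n (G ++ [:: GOr i1 i2]) by rewrite cats1.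
  have [_ lt1' h1'] := computes_cat (computes_cat c1 wf2) wf3'.
  have [_ lt2' h2'] := computes_cat c2 wf3'.
  rewrite cats1 -/G3 in lt1' h1' lt2' h2'.
  have cAnd := @computes_gate n G3 (GAnd i1 i2)
    (fun x => feval (fun j : 'I_n => nth false x j) f
           && feval (fun j : 'I_n => nth false x j) g) wf3.
  have {cAnd} [|x sx|wf4 lt4 h4] := cAnd; first by rewrite /= lt1'.
    by rewrite /= h1' // h2'.
  set G4 := rcons G3 _ in wf4 lt4 h4.
  have cNot := @computes_gate n G4 (GNot (n + size G3))
    (fun x => ~~ (feval (fun j : 'I_n => nth false x j) f
           && feval (fun j : 'I_n => nth false x j) g)) wf4.
  have {cNot} [//|x sx|wf5 lt5 h5] := cNot; first by rewrite /= h4.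
  set G5 := rcons G4 _ in wf5 lt5 h5.
  have wf5' : gates_wf n (G3 ++ [:: GAnd i1 i2; GNot (n + size G3)]).
    by rewrite -cat_rcons cats1.
  have c3 : computes n G3 (n + size G)
      (fun x => feval (fun j : 'I_n => nth false x j) f
           || feval (fun j : 'I_n => nth false x j) g) by [].
  have [_ lt3' h3'] := computes_cat c3 wf5'.
  rewrite -cat_rcons cats1 -/G4 -/G5 in lt3' h3'.
  exists ((gs1 ++ gs2) ++ [:: GOr i1 i2; GAnd i1 i2; GNot (n + size G3);
            GAnd (n + size G) (n + size G4)]), (n + size G5).
  split; first by rewrite !size_cat /= mulnS mulnDr; lia.
  rewrite !catA -/G -cat_rcons -/G3 -cat_rcons -/G4 -cat_rcons -/G5 cats1.
  apply: computes_gate => //=; first by rewrite lt3'.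
  move=> x sx; rewrite h3' // h5 //; by case: (feval _ f); case: (feval _ g).
Qed.

(** * Projections of formulas and their closure properties *)

Definition sum_env (V W : Type) (e : V -> bool) (w : W -> bool)
  (x : V + W) : bool := match x with inl v => e v | inr u => w u end.

(* [nd s P]: the predicate [P] on assignments of the variables [V] is the
   projection of a Boolean formula; [s] bounds the size of the formula plus the
   number of existentially quantified variables. *)
Definition nd (V : Type) (s : nat) (P : (V -> bool) -> Prop) : Prop :=
  exists (W : finType) (f : form (V + W)), #|W| + fsize f <= s /\
    forall e, P e <-> exists w : W -> bool, feval (sum_env e w) f.

Lemma nd_ext V s (P Q : (V -> bool) -> Prop) :
  (forall e, P e <-> Q e) -> nd s P -> nd s Q.
Proof.
by move=> PQ [W [f [sf hf]]]; exists W, f; split=> // e; rewrite -PQ hf.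
Qed.

Lemma nd_leq V s s' (P : (V -> bool) -> Prop) : s <= s' -> nd s P -> nd s' P.
Proof.
by move=> ss [W [f [sf hf]]]; exists W, f; split=> //; exact: leq_trans ss.
Qed.

Lemma nd_form V (f : form V) : nd (fsize f) (fun e => feval e f).
Proof.
exists void, (frename inl f); rewrite card_void add0n fsize_rename; split=> // e.
split=> [ef|[w]]; last by rewrite feval_rename.
by exists (fun _ => false); rewrite feval_rename.
Qed.

(** A proposition free of the input is decided classically and hard-wired, which non-uniformity
    permits. *)
Lemma nd_const V (Q : Prop) : nd 1 (fun _ : V -> bool => Q).
Proof.
apply: nd_ext (@nd_form V (FConst `[< Q >])) => e /=.
by split=> /asboolP.
Qed.

Lemma nd_lit V (v : V) b : nd 3 (fun e => e v = b).
Proof.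
apply: nd_ext (nd_form (FXor (FVar v) (FConst (~~ b)))) => e /=.
by case: (e v); case: b.
Qed.

Lemma nd_eq_var V (v v' : V) : nd 5 (fun e => e v = e v').
Proof.
apply: nd_ext (nd_form (FNot (FXor (FVar v) (FVar v')))) => e /=.
by case: (e v); case: (e v').
Qed.

Lemma nd_and V s s' (P Q : (V -> bool) -> Prop) :
  nd s P -> nd s' Q -> nd (s + s').+1 (fun e => P e /\ Q e).
Proof.
move=> [W [f [sf hf]]] [W' [g [sg hg]]].
pose r (x : V + W) : V + (W + W') :=
  match x with inl v => inl v | inr u => inr (inl u) end.
pose r' (x : V + W') : V + (W + W') :=
  match x with inl v => inl v | inr u => inr (inr u) end.
exists (W + W')%type, (FAnd (frename r f) (frename r' g)).
rewrite /= !fsize_rename card_sum; split; first lia.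
move=> e; rewrite hf hg; split=> [[[w hw] [w' hw']]|[w]].
  exists (sum_env w w'); rewrite !feval_rename; apply/andP; split.
    by apply: feval_imp hw => -[].
  by apply: feval_imp hw' => -[].
rewrite !feval_rename => /andP[h1 h2]; split.
  by exists (w \o inl); apply: feval_imp h1 => -[].
by exists (w \o inr); apply: feval_imp h2 => -[].
Qed.

Lemma nd_or V s s' (P Q : (V -> bool) -> Prop) :
  nd s P -> nd s' Q -> nd (s + s' + 7) (fun e => P e \/ Q e).
Proof.
move=> [W [f [sf hf]]] [W' [g [sg hg]]].
pose r (x : V + W) : V + (W + W') :=
  match x with inl v => inl v | inr u => inr (inl u) end.
pose r' (x : V + W') : V + (W + W') :=
  match x with inl v => inl v | inr u => inr (inr u) end.
exists (W + W')%type, (FOr (frename r f) (frename r' g)).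
rewrite [fsize _]/= !fsize_rename card_sum; split; first lia.
move=> e; rewrite hf hg; split=> [[[w hw]|[w hw]]|[w]].
- exists (sum_env w (fun=> false)); rewrite feval_or !feval_rename.
  by apply/orP; left; apply: feval_imp hw => -[].
- exists (sum_env (fun=> false) w); rewrite feval_or !feval_rename.
  by apply/orP; right; apply: feval_imp hw => -[].
rewrite feval_or !feval_rename => /orP[h|h]; [left|right].
  by exists (w \o inl); apply: feval_imp h => -[].
by exists (w \o inr); apply: feval_imp h => -[].
Qed.

(** A universal quantifier over a small index type commutes with projection because each conjunct
    gets its own copy of the witness variables. *)
Lemma nd_forall V (I : finType) s (P : I -> (V -> bool) -> Prop) :
  (forall i, nd s (P i)) -> nd (#|I| * s.+1).+1 (fun e => forall i, P i e).
Proof.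
move=> ndP; have H : forall r : seq I, nd (size r * s.+1).+1
    (fun e => forall i, i \in r -> P i e).
  elim=> [|i r IH]; first by apply: nd_ext (nd_const V True) => e; split.
  apply: nd_leq (nd_ext _ (nd_and (ndP i) IH)) => [|e] /=; first lia.
  split=> [[pi pr] j|h]; first by rewrite inE => /predU1P[->|/pr].
  by split=> [|j jr]; apply: h; rewrite inE ?eqxx ?jr ?orbT.
rewrite cardE; apply: nd_ext (H (enum I)) => e.
by split=> h i => [|_]; apply: h; rewrite mem_enum.
Qed.

Lemma nd_exists V (I : finType) s (P : I -> (V -> bool) -> Prop) :
  (forall i, nd s (P i)) ->
  nd (#|I| * (s + 7)).+1 (fun e => exists i, P i e).
Proof.
move=> ndP; have H : forall r : seq I, nd (size r * (s + 7)).+1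
    (fun e => exists2 i, i \in r & P i e).
  elim=> [|i r IH].
    by apply: nd_ext (nd_const V False) => e; split=> // -[].
  apply: nd_leq (nd_ext _ (nd_or (ndP i) IH)) => [|e] /=; first lia.
  split=> [[pi|[j jr pj]]|[j]]; first by exists i; rewrite ?inE ?eqxx.
    by exists j; rewrite ?inE ?jr ?orbT.
  by rewrite inE => /predU1P[->|jr] pj; [left|right; exists j].
rewrite cardE; apply: nd_ext (H (enum I)) => e.
by split=> [[i _ pi]|[i pi]]; exists i; rewrite ?mem_enum.
Qed.

Lemma nd_forall_ord V m s (P : 'I_m -> (V -> bool) -> Prop) :
  (forall i, nd s (P i)) -> nd (m * s.+1).+1 (fun e => forall i, P i e).
Proof. by move=> /nd_forall; rewrite card_ord. Qed.

Lemma nd_exists_ord V m s (P : 'I_m -> (V -> bool) -> Prop) :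
  (forall i, nd s (P i)) -> nd (m * (s + 7)).+1 (fun e => exists i, P i e).
Proof. by move=> /nd_exists; rewrite card_ord. Qed.

Lemma nd_imp_lit V (v : V) b s (Q : (V -> bool) -> Prop) :
  nd s Q -> nd (s + 10) (fun e => e v = b -> Q e).
Proof.
move=> ndQ; apply: nd_leq (nd_ext _ (nd_or (nd_lit v (~~ b)) ndQ)) => [|e].
  lia.
by split=> [[->|]|]; case: (e v); case: b => //=; auto.
Qed.

Lemma nd_project V (U : finType) s (P : (V + U -> bool) -> Prop) :
  nd s P ->
  nd (#|U| + s) (fun e => exists u : U -> bool, P (sum_env e u)).
Proof.
move=> [W [f [sf hf]]].
pose r (x : V + U + W) : V + (U + W) := match x with
  | inl (inl v) => inl v | inl (inr u) => inr (inl u) | inr w => inr (inr w)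
  end.
exists (U + W)%type, (frename r f); rewrite fsize_rename card_sum.
split=> [|e]; first by rewrite -addnA leq_add2l.
split=> [[u /hf [w hw]]|[w hw]].
  exists (sum_env u w); rewrite feval_rename.
  by apply: feval_imp hw => -[[]|].
exists (w \o inl); apply/hf; exists (w \o inr).
by rewrite feval_rename in hw; apply: feval_imp hw => -[[]|].
Qed.

Lemma nd_rename V V' (r : V -> V') s (P : (V -> bool) -> Prop) :
  nd s P -> nd s (fun e => P (e \o r)).
Proof.
move=> [W [f [sf hf]]].
pose r' (x : V + W) : V' + W :=
  match x with inl v => inl (r v) | inr u => inr u end.
exists W, (frename r' f); rewrite fsize_rename; split=> // e.
rewrite hf; split=> -[w hw]; exists w;
  move: hw; rewrite feval_rename; by apply: feval_imp => -[].
Qed.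

(** Hidden variables become certificate bits placed after the input bits, so a projection is what a
    non-uniform NP verifier accepts. *)
Lemma nd_circuit n s (P : ('I_n -> bool) -> Prop) : nd s P ->
  exists w (V : circuit (n + w) 1), circuit_size V <= n + 5 * s + 1 /\
    forall x : n.-tuple bool, P (tnth x) <->
      exists y : w.-tuple bool, thead (Defs.eval V [tuple of x ++ y]).
Proof.
move=> [W [f [sf hf]]].
pose r (x : 'I_n + W) : 'I_(n + #|W|) := match x with
  | inl i => lshift _ i | inr u => rshift _ (enum_rank u) end.
have [gs [i [sgs [/= wf lti hi]]]] :=
  @compile (n + #|W|) (frename r f) [::] isT.
have owf : all (fun i => i < n + #|W| + size gs) [tuple i] by rewrite /= lti.
exists #|W|, (Circuit wf owf); split.
  rewrite /circuit_size /=; rewrite fsize_rename in sgs.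
  clear -sf sgs; set a := #|W| in sf *; set b := fsize f in sf sgs *; lia.
move=> x; rewrite hf; have ev (y : #|W|.-tuple bool) : thead (Defs.eval (Circuit wf owf)
    [tuple of x ++ y]) = feval (sum_env (tnth x) (tnth y \o enum_rank)) f.
  rewrite /thead tnth_map /= hi ?size_cat ?size_tuple // feval_rename.
  apply: feval_ext => -[j|u] /=; rewrite nth_cat size_tuple.
    by rewrite ltn_ord (tnth_nth false).
  by rewrite ltnNge leq_addr /= addKn (tnth_nth false).
split=> [[w hw]|[y]]; last by rewrite ev; exists (tnth y \o enum_rank).
exists [tuple w (enum_val i) | i < #|W|]; rewrite ev.
apply: feval_imp hw => -[//|u] /=.
by rewrite tnth_mktuple enum_rankK.
Qed.

(** * Circuit evaluation as a projection *)

Lemma eval_gate_agree m g (w w' : seq bool) : gate_wf m g ->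
  (forall i, i < m -> nth false w i = nth false w' i) ->
  eval_gate w g = eval_gate w' g.
Proof.
case: g => [//|i|i j|i j] /= wf ww'; first by rewrite ww'.
  by case/andP: wf => wi wj; rewrite !ww'.
by case/andP: wf => wi wj; rewrite !ww'.
Qed.

Lemma gates_wf_nth n gs k : gates_wf n gs -> k < size gs ->
  gate_wf (n + k) (nth (GConst false) gs k).
Proof.
elim: gs n k => [//|g gs IH] n [|k] /= /andP[wg wgs] lk; first by rewrite addn0.
by rewrite -addSnnS; exact: IH.
Qed.

(** A gate reads only earlier wires, which later gates leave alone, so its equation holds for the
    final wire list. *)
Lemma nth_wires n gs x k : size x = n -> gates_wf n gs -> k < size gs ->
  nth false (wires gs x) (n + k) =
  eval_gate (wires gs x) (nth (GConst false) gs k).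
Proof.
move=> sx wf lk; have wfk := gates_wf_nth wf lk.
have E : gs = rcons (take k gs) (nth (GConst false) gs k) ++ drop k.+1 gs.
  by rewrite -take_nth // cat_take_drop.
have sk : size (take k gs) = k by rewrite size_take lk.
rewrite {1}E nth_wires_cat ?size_rcons ?sx ?sk ?addnS //.
rewrite wires_rcons nth_rcons size_wires sx sk ltnn eqxx.
apply: eval_gate_agree wfk _ => i li.
rewrite -{2}(cat_take_drop k gs) nth_wires_cat ?sx ?sk //.
Qed.

(** The gate equations determine every wire by induction on its index, so guessed wires that satisfy
    them are the actual computation. *)
Lemma wires_unique n gs x w : size x = n -> gates_wf n gs ->
  size w = n + size gs ->
  (w = wires gs x) <->
  ((forall i : 'I_n, nth false w i = nth false x i) /\
   forall k : 'I_(size gs),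
     nth false w (n + k) = eval_gate w (nth (GConst false) gs k)).
Proof.
move=> sx wf sw.
have xw (i : 'I_n) : nth false (wires gs x) i = nth false x i.
  by rewrite -(cat0s gs) nth_wires_cat //= addn0 sx.
split=> [->|[hx hg]]; first by split=> // k; apply: nth_wires.
apply: (@eq_from_nth _ false) => [|i]; first by rewrite size_wires sx.
elim/ltn_ind: i => i IH li; have [lin|nli] := ltnP i n.
  by rewrite (hx (Ordinal lin)) -(xw (Ordinal lin)).
have lk : i - n < size gs by rewrite ltn_subLR // -sw.
rewrite -(subnKC nli) (hg (Ordinal lk)) nth_wires //=.
apply: eval_gate_agree (gates_wf_nth wf lk) _; rewrite subnKC // => j lj.
by apply: IH => //; exact: ltn_trans li.
Qed.

Section Lookup.
Variables (V : Type) (N : nat).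

(** An index out of range yields false, in agreement with the default value of [nth false]. *)
Definition lookup i : form (V + 'I_N) :=
  if insub i is Some o then FVar (inr o) else FConst false.

Definition gate_form g : form (V + 'I_N) :=
  match g with
  | GConst b => FConst b
  | GNot i => FNot (lookup i)
  | GAnd i j => FAnd (lookup i) (lookup j)
  | GOr i j => FOr (lookup i) (lookup j)
  end.

Lemma feval_lookup e (w : 'I_N -> bool) i :
  feval (sum_env e w) (lookup i) = nth false [tuple w o | o < N] i.
Proof.
rewrite /lookup; case: insubP => [j lj <-|]; first by rewrite nth_mktuple.
by rewrite -leqNgt => Ni; rewrite nth_default // size_tuple.
Qed.

Lemma feval_gate_form e (w : 'I_N -> bool) g :
  feval (sum_env e w) (gate_form g) = eval_gate [tuple w o | o < N] g.
Proof.
case: g => [//|i|i j|i j]; rewrite /gate_form.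
- by rewrite feval_not feval_lookup.
- by rewrite [feval _ _]/= !feval_lookup.
- by rewrite feval_or !feval_lookup.
Qed.

Lemma fsize_lookup i : fsize (lookup i) = 1.
Proof. by rewrite /lookup; case: insub. Qed.

Lemma fsize_gate_form g : fsize (gate_form g) <= 9.
Proof. by case: g => [//|i|i j|i j]; rewrite /= ?fsize_lookup. Qed.

End Lookup.

Lemma nd_iff_form V (f g : form V) :
  nd (fsize f + fsize g + 3) (fun e => feval e f = feval e g).
Proof.
apply: nd_leq (nd_ext _ (nd_form (FNot (FXor f g)))) => [|e] /=; first lia.
by case: (feval e f); case: (feval e g).
Qed.

(** Tseitin's encoding: wires are guessed and each gate is checked locally at cost at most 14.
    Substituting formulas for wires could grow exponentially, since fan-out is unbounded. *)
Lemma nd_eval n m (C : circuit n m) :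
  nd (15 * circuit_size C + 5) (fun e : 'I_n + 'I_m -> bool =>
    Defs.eval C [tuple e (inl i) | i < n] = [tuple e (inr j) | j < m]).
Proof.
set N := n + size (gates C).
have H : nd (#|'I_N| + ((#|'I_n| * 14).+1 +
    ((#|'I_(size (gates C))| * 14).+1 + (#|'I_m| * 14).+1).+1).+1)
  (fun e => exists w : 'I_N -> bool,
    (forall i : 'I_n, feval (sum_env e w) (lookup _ _ i) =
       feval (sum_env e w) (FVar (inl (inl i)))) /\
    (forall k : 'I_(size (gates C)),
       feval (sum_env e w) (lookup _ _ (n + k)) =
       feval (sum_env e w) (gate_form ('I_n + 'I_m) N
         (nth (GConst false) (gates C) k))) /\
    (forall j : 'I_m, feval (sum_env e w) (lookup _ _ (tnth (outputs C) j)) =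
       feval (sum_env e w) (FVar (inl (inr j))))).
  apply: (nd_project (P := fun ew => (forall i : 'I_n,
      feval ew (lookup _ _ i) = feval ew (FVar (inl (inl i)))) /\
    (forall k : 'I_(size (gates C)), feval ew (lookup _ _ (n + k)) =
       feval ew (gate_form ('I_n + 'I_m) N
         (nth (GConst false) (gates C) k))) /\
    (forall j : 'I_m, feval ew (lookup _ _ (tnth (outputs C) j)) =
       feval ew (FVar (inl (inr j)))))).
  apply: nd_and; last apply: nd_and; apply: nd_forall => i;
    apply: nd_leq (nd_iff_form _ _); rewrite fsize_lookup //=.
  by have := fsize_gate_form ('I_n + 'I_m) N (nth (GConst false) (gates C) i); lia.
apply: nd_leq (nd_ext _ H).
  by rewrite /circuit_size /N !card_ord; lia.
move=> e; set x := [tuple e (inl i) | i < n].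
have wu (w : N.-tuple bool) := wires_unique (size_tuple x) (gates_wfP C)
  (size_tuple w).
split=> [[w [hi [hg ho]]]|ex].
  have/wu E : (forall i : 'I_n, nth false [tuple w o | o < N] i = nth false x i)
    /\ forall k : 'I_(size (gates C)),
     nth false [tuple w o | o < N] (n + k) =
     eval_gate [tuple w o | o < N] (nth (GConst false) (gates C) k).
    split=> [i|k].
      by move: (hi i); rewrite feval_lookup => ->; rewrite /= nth_mktuple.
    by move: (hg k); rewrite feval_lookup feval_gate_form.
  apply: eq_from_tnth => j; rewrite tnth_map -E -(feval_lookup e) ho.
  by rewrite tnth_mktuple.
have sW : size (wires (gates C) x) == N by rewrite size_wires size_tuple.
pose W := Tuple sW; have [hi hg] := (wu W).1 erefl.
have WE : [tuple tnth W o | o < N] = W.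
  by apply: eq_from_tnth => o; rewrite tnth_mktuple.
exists (tnth W); split; [|split] => i; rewrite feval_lookup WE.
- by rewrite hi /= nth_mktuple.
- by rewrite feval_gate_form WE hg.
- by rewrite /= -(tnth_mktuple (fun j => e (inr j))) -ex tnth_map.
Qed.

(** * The canonical encoding of a set as a projection *)

Lemma nth_flatten_slots n (l : seq (n.-tuple bool)) j q : q <= n ->
  nth false (flatten [seq true :: tval v | v <- l]) (j * n.+1 + q) =
  if j < size l then nth false (true :: nth (nseq n false) (map val l) j) q
  else false.
Proof.
move=> qn; elim: l j => [|v l IH] j /=; first by rewrite nth_nil.
case: j => [|j].
  rewrite mul0n add0n -cat_cons nth_cat /= size_tuple ltnS qn //.
rewrite -cat_cons nth_cat /= size_tuple mulSn -addnA ltnNge leq_addr /=.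
by rewrite addKn IH.
Qed.

(** Meant for the occupancy flags of the slots. If none is set, the empty maximum gives the required
    0. *)
Lemma initial_segment t (f : 'I_t -> bool) :
  (forall j j' : 'I_t, j < j' -> f j' -> f j) ->
  exists2 c, c <= t & forall j : 'I_t, f j = (j < c).
Proof.
move=> dc; exists (\max_(j | f j) j.+1).
  by apply/bigmax_leqP => j _; exact: ltn_ord.
move=> j; apply/idP/idP => [fj|]; first exact: (@leq_bigmax_cond _ f (fun j => j.+1)).
have [/existsP[j0 fj0]|/existsPn nf] := boolP [exists j, f j]; last first.
  by rewrite big_pred0 // => i; exact/negbTE.
have f0 : 0 < #|f| by apply/card_gt0P; exists j0.
have [i fi ->] := eq_bigmax_cond (fun j : 'I_t => j.+1) f0.
by rewrite ltnS leq_eqVlt => /predU1P[/val_inj->|/dc->].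
Qed.

Lemma slexP n (u v : n.-tuple bool) :
  reflect (exists q : 'I_n, [/\ tnth u q = false, tnth v q = true &
     forall q' : 'I_n, q' < q -> tnth u q' = tnth v q'])
  (@Order.lt _ (seqlexi bool) (tval u) (tval v)).
Proof.
case: n u v => [|n] u v.
  rewrite (tuple0 u) (tuple0 v) Order.POrderTheory.ltxx.
  by constructor=> -[[]].
suff H : forall m (a b : seq bool), size a = m -> size b = m ->
    (@Order.lt _ (seqlexi bool) a b <-> exists q, [/\ q < m,
     nth false a q = false, nth false b q = true & forall q', q' < q ->
     nth false a q' = nth false b q']).
  apply: (iffP idP) => [/(H n.+1 _ _ (size_tuple u) (size_tuple v))|].
    move=> [q [lq uq vq hq]]; exists (Ordinal lq).
    by rewrite !(tnth_nth false); split=> // q' lq'; rewrite !(tnth_nth false) hq.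
  move=> [q [uq vq hq]]; apply/(H n.+1 _ _ (size_tuple u) (size_tuple v)).
  exists q; rewrite -!tnth_nth; split=> // q' lq'.
  have ln : q' < n.+1 by exact: ltn_trans lq' (ltn_ord q).
  by have := hq (Ordinal ln) lq'; rewrite !(tnth_nth false).
elim=> [|m IH] [|x a] [|y b] //=.
  by move=> _ _; rewrite Order.POrderTheory.ltxx; split=> // -[q []].
move=> [sa] [sb]; rewrite ltxi_cons; have {}IH := IH _ _ sa sb.
split.
  case: x; case: y => //=.
  - by move=> /IH [q [lq uq vq hq]]; exists q.+1; split=> // -[].
  - by move=> _; exists 0.
  - by move=> /IH [q [lq uq vq hq]]; exists q.+1; split=> // -[].
move=> [[|q] [/= lq uq vq hq]]; first by rewrite uq vq.
have := hq 0 isT => /= ->; rewrite Order.POrderTheory.lexx /=.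
apply/IH; exists q; split=> // q' lq'; exact: (hq q'.+1).
Qed.

Section Encoding.
Variables (t n : nat).

Lemma unflat_subproof (i : 'I_(t * n.+1)) : i %/ n.+1 < t.
Proof. by rewrite ltn_divLR. Qed.

Definition unflat (i : 'I_(t * n.+1)) : 'I_t * 'I_n.+1 :=
  (Ordinal (unflat_subproof i), inord (i %% n.+1)).

Lemma flat_subproof (j : 'I_t) (q : 'I_n.+1) : j * n.+1 + q < t * n.+1.
Proof.
apply: leq_trans (leq_mul (ltn_ord j) (leqnn n.+1)).
by rewrite mulSn addnC ltn_add2r.
Qed.

Definition flat (j : 'I_t) (q : 'I_n.+1) := Ordinal (flat_subproof j q).

Lemma flatK j q : unflat (flat j q) = (j, q).
Proof.
congr pair; apply: val_inj => /=; first by rewrite divnMDl // divn_small ?addn0.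
by rewrite modnMDl modn_small // inordK.
Qed.

Lemma unflatK i : flat (unflat i).1 (unflat i).2 = i.
Proof.
by apply: val_inj; rewrite /= inordK ?ltn_pmod // -divn_eq.
Qed.

Definition slot_list (X : {set n.-tuple bool}) : seq (n.-tuple bool) :=
  sort (@lex_le n) (enum X).

Lemma encode_setP (X : {set n.-tuple bool}) (s : 'I_t * 'I_n.+1 -> bool) :
  encode_set t X = [tuple s (unflat i) | i < t * n.+1] <->
  forall j q, s (j, q) = if j < size (slot_list X)
    then nth false (true :: nth (nseq n false) (map val (slot_list X)) j) q
    else false.
Proof.
split=> [E j q|H].
  have := congr1 (fun T => tnth T (flat j q)) E; rewrite !tnth_mktuple flatK => <-.
  by rewrite /= nth_flatten_slots // -ltnS.
apply: eq_from_tnth => i; rewrite !tnth_mktuple -[in LHS](unflatK i).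
case: (unflat i) => j q; rewrite H [val _]/= nth_flatten_slots //.
by rewrite -ltnS; exact: ltn_ord.
Qed.

Definition slot_val (s : 'I_t * 'I_n.+1 -> bool) (j : 'I_t) : n.-tuple bool :=
  [tuple s (j, lift ord0 q) | q < n].

(** Replaces sorting by checking: guessed slots are validated by comparing pairs of slots and by
    membership tests, all expressible in polynomial size. *)
Definition slots_ok (X : {set n.-tuple bool}) (s : 'I_t * 'I_n.+1 -> bool) :=
  [/\ forall j, s (j, ord0) = false -> forall q, s (j, lift ord0 q) = false,
      forall j j' : 'I_t, j < j' -> s (j', ord0) = true -> s (j, ord0) = true /\
        @Order.lt _ (seqlexi bool) (tval (slot_val s j)) (tval (slot_val s j')),
      forall x, x \in X -> exists j, s (j, ord0) = true /\ slot_val s j = x &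
      forall j, s (j, ord0) = true -> slot_val s j \in X].

Lemma size_slot_list (X : {set n.-tuple bool}) : size (slot_list X) = #|X|.
Proof. by rewrite size_sort cardE. Qed.

Lemma mem_slot_list (X : {set n.-tuple bool}) : slot_list X =i X.
Proof. by move=> x; rewrite mem_sort mem_enum. Qed.

Lemma slot_list_sorted (X : {set n.-tuple bool}) :
  sorted (@Order.lt _ (seqlexi bool)) (map (@tval n bool) (slot_list X)).
Proof.
rewrite Order.POrderTheory.lt_sorted_uniq_le map_inj_uniq; last exact: val_inj.
rewrite sort_uniq enum_uniq /= sorted_map.
by apply: sort_sorted => u v; exact: Order.TotalTheory.le_total.
Qed.

(** A strictly increasing list is determined by its set of elements; as the occupied slots form a
    prefix and the others are blank, every bit is fixed. The bound on [#|X|] gives each element a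
    slot. *)
Lemma slots_okP (X : {set n.-tuple bool}) (s : 'I_t * 'I_n.+1 -> bool) : #|X| <= t ->
  slots_ok X s <-> encode_set t X = [tuple s (unflat i) | i < t * n.+1].
Proof.
move=> Xt; rewrite encode_setP; split=> [[c1 c2 c3 c4]|H].
  have [j j' jj' sj'|c ct hc] := @initial_segment t (fun j => s (j, ord0)).
    by have [] := c2 _ _ jj' sj'.
  pose ys := [seq tval (slot_val s (widen_ord ct k)) | k <- enum 'I_c].
  have Eys : ys = map (@tval n bool) (slot_list X).
    apply: (@Order.POrderTheory.lt_sorted_eq _ (seqlexi bool)).
    - apply: pairwise_sorted; rewrite pairwise_map.
      apply: (@sub_pairwise _ (fun k k' : 'I_c => val k < val k')).
        move=> k k' kk'; have sk' : s (widen_ord ct k', ord0) by rewrite hc /=.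
        by have [] := c2 (widen_ord ct k) (widen_ord ct k') kk' sk'.
      rewrite -(pairwise_map val ltn) val_enum_ord.
      by rewrite -sorted_pairwise ?iota_ltn_sorted //; exact: ltn_trans.
    - exact: slot_list_sorted.
    move=> y; apply/mapP/mapP => [[k _ ->]|[x]].
      have sk : s (widen_ord ct k, ord0) by rewrite hc /=.
      by exists (slot_val s (widen_ord ct k)); rewrite ?mem_slot_list ?c4.
    rewrite mem_slot_list => /c3 [j [sj <-]] ->.
    rewrite hc in sj; exists (Ordinal sj); rewrite ?mem_enum //.
    by congr (tval (slot_val s _)); exact: val_inj.
  have sz : size (slot_list X) = c.
    by rewrite -(size_map (@tval n bool)) -Eys size_map size_enum_ord.
  move=> j q; rewrite sz -[map _ _]/(map (@tval n bool) (slot_list X)) -Eys.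
  case: (unliftP ord0 q) => [q' ->|->] /=; last by rewrite hc; case: ifP.
  rewrite -hc; case: ifPn => [sj|/negbTE/c1 -> //].
  rewrite add0n; rewrite hc in sj.
  rewrite (nth_map (Ordinal sj)) ?size_enum_ord // nth_mktuple.
  congr (s (_, _)); apply: val_inj => /=.
  by have := nth_ord_enum (Ordinal sj) (Ordinal sj) => /= ->.
pose l := map (@tval n bool) (slot_list X).
have sl : size l = #|X| by rewrite size_map size_slot_list.
have flag j : s (j, ord0) = (j < #|X|).
  by rewrite H size_slot_list /=; case: ifP.
have sv (j : 'I_t) : j < #|X| -> tval (slot_val s j) = nth (nseq n false) l j.
  move=> jX; have sn : size (nth (nseq n false) l j) = n.
    by rewrite (nth_map [tuple of nseq n false]) ?size_slot_list // size_tuple.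
  apply: (@eq_from_nth _ false) => [|q]; rewrite size_tuple ?sn // => lq.
  by rewrite (nth_mktuple _ _ (Ordinal lq)) H size_slot_list jX.
split=> [j sj q|j j' jj' sj'|x xX|j].
- by rewrite H size_slot_list -flag sj.
- rewrite flag in sj'; have jX := ltn_trans jj' sj'; rewrite flag jX !sv //.
  split=> //; have := slot_list_sorted X.
  rewrite (sorted_pairwise Order.POrderTheory.lt_trans).
  move/(pairwiseP (nseq n false)); apply=> //; by rewrite ?inE /= sl.
- have xl : x \in slot_list X by rewrite mem_slot_list.
  have li : index x (slot_list X) < #|X| by rewrite -size_slot_list index_mem.
  exists (Ordinal (leq_trans li Xt)); rewrite flag li; split=> //.
  apply: val_inj; apply: etrans (sv _ _) _ => //=.
  by rewrite (nth_map [tuple of nseq n false]) ?index_mem // nth_index.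
- rewrite flag => jX; rewrite -mem_slot_list.
  have := sv j jX; rewrite (nth_map [tuple of nseq n false]) ?size_slot_list //.
  by move/val_inj => ->; rewrite mem_nth // size_slot_list.
Qed.

(** Equal rows merge, so the slots of the encoding need not correspond to the rows. *)
Definition matrix_set (x : 'I_t * 'I_n -> bool) : {set n.-tuple bool} :=
  [set [tuple x (j, q) | q < n] | j in 'I_t].

Lemma card_matrix_set x : #|matrix_set x| <= t.
Proof. by rewrite (leq_trans (leq_imset_card _ _)) // card_ord. Qed.

Definition slex_size := (n * ((3 + (3 + (n * 6).+1).+1).+1 + 7)).+1.

Lemma nd_slex (V : Type) (r : 'I_t * 'I_n.+1 -> V) (j j' : 'I_t) :
  nd slex_size (fun e : V -> bool =>
    @Order.lt _ (seqlexi bool) (tval (slot_val (e \o r) j))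
      (tval (slot_val (e \o r) j')) : Prop).
Proof.
have H : nd slex_size (fun e : V -> bool => exists q : 'I_n,
    e (r (j, lift ord0 q)) = false /\ (e (r (j', lift ord0 q)) = true /\
    forall q' : 'I_n, q' < q ->
      e (r (j, lift ord0 q')) = e (r (j', lift ord0 q')))).
  apply: nd_exists_ord => q.
  apply: nd_and (nd_lit _ _) (nd_and (nd_lit _ _) _).
  apply: nd_forall_ord => q'.
  have [lq|_] := boolP (q' < q).
    by apply: nd_ext (nd_eq_var _ _) => e; split=> [h _|h]; [exact: h|exact: h isT].
  by apply: nd_leq (nd_ext _ (nd_const V True)).
apply: nd_ext H => e; split=> [[q [h0 [h1 h2]]]|/slexP[q [h0 h1 h2]]].
  by apply/slexP; exists q; rewrite !tnth_mktuple; split=> // q' /h2;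
    rewrite !tnth_mktuple.
rewrite !tnth_mktuple in h0 h1; exists q; split=> //; split=> // q' /h2.
by rewrite !tnth_mktuple.
Qed.

Definition row_eq_size := (n * 6).+1.

Definition slots_size :=
  ((t * ((n * 4).+1 + 10).+1).+1 + ((t * (t * ((3 + slex_size).+1 + 10).+1).+2).+1
   + ((t * (t * ((3 + row_eq_size).+1 + 7)).+2).+1 +
      (t * ((t * (row_eq_size + 7)).+1 + 10).+1).+1).+1).+1).+1.

Lemma nd_slots_ok : nd slots_size
  (fun e : 'I_t * 'I_n + 'I_t * 'I_n.+1 -> bool =>
     slots_ok (matrix_set (e \o inl)) (e \o inr)).
Proof.
pose V := ('I_t * 'I_n + 'I_t * 'I_n.+1)%type.
have row i j : nd row_eq_size (fun e : V -> bool =>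
    slot_val (e \o inr) j = [tuple (e \o inl) (i, q) | q < n]).
  apply: nd_ext (_ : nd _ (fun e : V -> bool => forall q : 'I_n,
      e (inr (j, lift ord0 q)) = e (inl (i, q)))) => [e|].
    split=> [h|h q]; first by apply: eq_from_tnth => q; rewrite !tnth_mktuple /= h.
    by have := congr1 (fun T => tnth T q) h; rewrite !tnth_mktuple.
  by apply: nd_forall_ord => q; exact: nd_eq_var.
have H : nd slots_size (fun e : V -> bool =>
    (forall j, e (inr (j, ord0)) = false ->
       forall q : 'I_n, e (inr (j, lift ord0 q)) = false) /\
    ((forall j j' : 'I_t, j < j' -> e (inr (j', ord0)) = true ->
        e (inr (j, ord0)) = true /\ @Order.lt _ (seqlexi bool)
          (tval (slot_val (e \o inr) j)) (tval (slot_val (e \o inr) j'))) /\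
    ((forall i, exists j, e (inr (j, ord0)) = true /\
       slot_val (e \o inr) j = [tuple (e \o inl) (i, q) | q < n]) /\
    (forall j, e (inr (j, ord0)) = true -> exists i,
       slot_val (e \o inr) j = [tuple (e \o inl) (i, q) | q < n])))).
  rewrite /slots_size; apply: nd_and; last apply: nd_and; last apply: nd_and.
  - apply: nd_forall_ord => j; apply: nd_imp_lit.
    by apply: nd_forall_ord => q; exact: nd_lit.
  - apply: nd_forall_ord => j.
    apply: nd_forall_ord => j'.
    have [lj|_] := boolP (j < j'); last first.
      by apply: nd_leq (nd_ext _ (nd_const V True)).
    apply: nd_ext (nd_imp_lit (inr (j', ord0) : V) true (nd_and
      (nd_lit (inr (j, ord0) : V) true)
      (nd_slex inr j j'))) => e; split=> [h _ /h //|h /h].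
    by apply.
  - apply: nd_forall_ord => i.
    apply: nd_exists_ord => j.
    exact: nd_and (nd_lit _ _) (row i j).
  apply: nd_forall_ord => j; apply: nd_imp_lit.
  by apply: nd_exists_ord => i; exact: row.
apply: nd_ext H => e; split=> [[h1 [h2 [h3 h4]]]|[h1 h2 h3 h4]].
  split=> //; first by move=> x /imsetP[i _ ->].
  by move=> j /h4 [i ->]; apply: imset_f.
split=> //; split=> //; split=> [i|j /h4 /imsetP[i _ ->]]; last by exists i.
by apply: h3; apply: imset_f.
Qed.

End Encoding.

(** * Information and hashing *)

Local Open Scope ring_scope.

(** * Inequalities for exponential and logarithm *)

Section Analysis.
Variable R : realType.
Implicit Types x y u : R.

Lemma ln_le_sub1 x : 0 < x -> ln x <= x - 1.
Proof. by move=> x0; rewrite -{1}(subrK 1 x) addrC le_ln1Dx // ltrBDr addNr. Qed.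

(** From [expR (- x) >= 1 - x] one gets [expR x <= 1 / (1 - x)], and the quadratic exceeds this
    bound by x^2 (1 - 2x) / (1 - x). It controls the exponential moments in [upper_tail]. *)
Lemma expR_le_quad x : x <= 1 / 2 -> expR x <= 1 + x + 2 * x ^+ 2.
Proof.
move=> hx; have h1 : 0 < 1 - x by lra.
have h2 : expR x * (1 - x) <= 1.
  rewrite -[leRHS](expRxMexpNx_1 x) ler_wpM2l ?expR_ge0 //.
  by have := expR_ge1Dx (- x); lra.
rewrite -(ler_pM2r h1) (le_trans h2) //.
rewrite -subr_ge0 (_ : _ - 1 = x ^+ 2 * (1 - 2 * x)); last by ring.
by rewrite mulr_ge0 ?sqr_ge0 //; lra.
Qed.

Lemma le_of_derive_ge0 (f df : R -> R) u : 0 <= u ->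
  (forall x, 0 <= x <= u -> is_derive x 1 f (df x)) ->
  (forall x, 0 <= x <= u -> 0 <= df x) -> f 0 <= f u.
Proof.
rewrite le_eqVlt => /predU1P[<- //|u0] dfE df0.
have [x|x|c] := @MVT R f df 0 u u0.
- by rewrite in_itv /= => /andP[x0 xu]; apply: dfE; rewrite !ltW.
- apply: derivable_within_continuous => {}x; rewrite in_itv /= => /dfE.
  by move=> [].
rewrite in_itv /= => /andP[c0 cu] E; rewrite -subr_ge0 E subr0.
by rewrite mulr_ge0 ?df0 ?ltW.
Qed.

Lemma ln_ratio_ge u : 0 <= u < 1 -> 2 * u <= ln (1 + u) - ln (1 - u).
Proof.
move=> /andP[u0 u1].
pose f x := ln (1 + x) - ln (1 - x) - 2 * x.
pose df x := (1 + x)^-1 + (1 - x)^-1 - 2.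
have := @le_of_derive_ge0 f df u u0.
rewrite {1 2}/f addr0 subr0 ln1 mulr0 !subr0 subr_ge0; apply.
  move=> x /andP[x0 xu].
  have p1 : 0 < 1 + x by lra.
  have p2 : 0 < 1 - x by lra.
  have d1 := is_derive1_ln p1; have d2 := is_derive1_ln p2.
  rewrite /f; apply: is_derive_eq; rewrite /df -[2%:A]/(2 * 1 : R) /=; ring.
move=> x /andP[x0 xu]; rewrite /df.
have p1 : 0 < 1 + x by lra.
have p2 : 0 < 1 - x by lra.
have -> : (1 + x)^-1 + (1 - x)^-1 - 2 = 2 * x ^+ 2 / ((1 + x) * (1 - x)).
  by field; rewrite !gt_eqF.
by rewrite divr_ge0 ?mulr_ge0 ?sqr_ge0 // ltW.
Qed.

(** Pinsker's inequality for one bit: the right-hand side is twice the gap between ln 2 and the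
    entropy of a bit with probabilities (1 + u) / 2 and (1 - u) / 2. The derivative of the
    difference of the two sides is nonnegative by [ln_ratio_ge]. *)
Lemma binary_entropy_ge u : 0 <= u < 1 ->
  u ^+ 2 <= (1 + u) * ln (1 + u) + (1 - u) * ln (1 - u).
Proof.
move=> /andP[u0 u1].
pose f x := (1 + x) * ln (1 + x) + (1 - x) * ln (1 - x) - x ^+ 2.
pose df x := ln (1 + x) - ln (1 - x) - 2 * x.
have := @le_of_derive_ge0 f df u u0.
rewrite {1 2}/f addr0 subr0 ln1 !mulr0 expr0n /= addr0 subr0 subr_ge0; apply.
  move=> x /andP[x0 xu].
  have p1 : 0 < 1 + x by lra.
  have p2 : 0 < 1 - x by lra.
  have d1 := is_derive1_ln p1; have d2 := is_derive1_ln p2.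
  rewrite /f; apply: is_derive_eq; rewrite /df /GRing.scale /=.
  have := mulfV (lt0r_neq0 p1); have := mulfV (lt0r_neq0 p2); nra.
by move=> x /andP[x0 xu]; rewrite subr_ge0 ln_ratio_ge // x0; lra.
Qed.

Lemma ln_prod (I : finType) (F : I -> R) : (forall i, 0 < F i) ->
  ln (\prod_i F i) = \sum_i ln (F i).
Proof.
move=> F0; suff [] : 0 < \prod_i F i /\ ln (\prod_i F i) = \sum_i ln (F i) by [].
apply: (big_ind2 (fun p s => 0 < p /\ ln p = s)); rewrite ?ln1 //.
by move=> p1 s1 p2 s2 [p10 <-] [p20 <-]; rewrite mulr_gt0 // lnM.
Qed.

End Analysis.

(** * Entropy and information by counting fibres *)

Section Counting.
Variable R : realType.

Definition avg (T : finType) (f : T -> R) : R := (\sum_x f x) / #|T|%:R.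

Definition fiber (S T : finType) (c : S -> T) (y : T) : nat :=
  #|[pred w | c w == y]|.

(* If [w] is uniform then [mean_log_fiber c] is the conditional entropy of [w]
   given [c w], in nats; the entropy of [c w] is [ln #|S|] minus this. *)
Definition mean_log_fiber (S T : finType) (c : S -> T) : R :=
  avg (fun w => ln (fiber c (c w))%:R).

Section Fibers.
Variables (S T : finType) (c : S -> T).

Lemma fiber_gt0 w : (0 < fiber c (c w))%N.
Proof. by apply/card_gt0P; exists w; rewrite inE. Qed.

Lemma fiberR_gt0 w : 0 < (fiber c (c w))%:R :> R.
Proof. by rewrite ltr0n fiber_gt0. Qed.

Lemma sum_comp (F : T -> R) :
  \sum_w F (c w) = \sum_y (fiber c y)%:R * F y.
Proof.
rewrite (partition_big c xpredT) //=; apply: eq_bigr => y _.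
rewrite (eq_bigr (fun=> F y)) => [|w /eqP -> //].
by rewrite sumr_const mulr_natl.
Qed.

Lemma sum_fiber : \sum_y (fiber c y)%:R = #|S|%:R :> R.
Proof.
under eq_bigr do rewrite -[_%:R]mulr1.
by rewrite -(@sum_comp (fun=> 1)) sumr_const.
Qed.

(** The weights sum to 1 over each nonempty fibre; points outside the image occur on the right
    only. *)
Lemma sum_div_fiber_le (h : T -> R) : (forall y, 0 <= h y) ->
  \sum_w h (c w) / (fiber c (c w))%:R <= \sum_y h y.
Proof.
move=> h0; rewrite (sum_comp (fun y => h y / (fiber c y)%:R)).
apply: ler_sum => y _; have [->|/eqP f0] := (fiber c y)%:R =P 0 :> R.
  by rewrite mul0r.
by rewrite mulrC divfK.
Qed.

Lemma fiber_leq y : (fiber c y <= #|S|)%N.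
Proof. exact: max_card. Qed.

End Fibers.

Lemma fiber_bit (S Z : finType) (b : S -> bool) (c : S -> Z) z :
  (fiber (fun w => (b w, c w)) (true, z) +
   fiber (fun w => (b w, c w)) (false, z) = fiber c z)%N.
Proof.
rewrite /fiber -(cardID [pred w | b w] [pred w | c w == z]); congr (_ + _)%N;
  by apply: eq_card => w; rewrite !inE xpair_eqE /=; case: (b w); case: (c w == z).
Qed.

Lemma sumr_1 (T : finType) : \sum_(w : T) (1 : R) = #|T|%:R.
Proof. by rewrite sumr_const. Qed.

(** Gibbs' inequality: [g / 2] is a guess for the conditional law of [b] given [c]. The right-hand
    side is ln 2 minus the conditional entropy of [b] given [c], which is their mutual information
    if [b] is uniform; every guess bounds it from below. *)
Lemma gibbs_bit (S Z : finType) (b : S -> bool) (c : S -> Z)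
    (g : bool -> Z -> R) : (0 < #|S|)%N ->
  (forall b z, 0 < g b z) -> (forall z, g true z + g false z <= 2) ->
  avg (fun w => ln (g (b w) (c w))) <=
  ln 2 + mean_log_fiber (fun w => (b w, c w)) - mean_log_fiber c.
Proof.
move=> S0 g0 g2; have SR0 : 0 < #|S|%:R :> R by rewrite ltr0n.
rewrite -subr_ge0 /mean_log_fiber /avg.
have -> : ln 2 = (\sum_(w : S) ln 2) / #|S|%:R :> R.
  by rewrite sumr_const -[ln 2 *+ _]mulr_natr mulfK // gt_eqF.
rewrite -mulrDl -mulrBl -mulrBl divr_ge0 ?(ltW SR0) //.
rewrite -big_split /= -!sumrB.
pose bc w := (b w, c w).
(* This is ln y <= y - 1 for the ratio [y] of guessed to true conditional probability. The mean of
   [y] is at most 1 because the guess has mass at most 1. *)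
have term w : 1 - (fiber c (c w))%:R * g (b w) (c w) / 2 / (fiber bc (bc w))%:R
   <= ln 2 + ln (fiber bc (bc w))%:R - ln (fiber c (c w))%:R - ln (g (b w) (c w)).
  have p1 := fiberR_gt0 c w; have p2 := fiberR_gt0 bc w.
  have p3 := g0 (b w) (c w).
  set y := _ * g _ _ / _ / _.
  have y0 : 0 < y by rewrite !divr_gt0 ?mulr_gt0.
  have := ln_le_sub1 y0.
  have -> : ln y = ln (fiber c (c w))%:R + ln (g (b w) (c w)) - ln 2
                   - ln (fiber bc (bc w))%:R.
    by rewrite /y !ln_div ?posrE ?divr_gt0 ?mulr_gt0 // lnM.
  by lra.
apply: le_trans (ler_sum _ (fun w _ => term w)).
rewrite sumrB sumr_1 subr_ge0.
pose h (bz : bool * Z) := (fiber c bz.2)%:R * g bz.1 bz.2 / 2.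
apply: le_trans (sum_div_fiber_le bc (h := h) _) _.
  by move=> [b' z]; rewrite /h !mulr_ge0 // ltW.
rewrite -(sum_fiber c) -(pair_bigA _ (fun b z => h (b, z))) exchange_big /=.
apply: ler_sum => z _; rewrite big_bool /h /=.
have := g2 z; have : 0 <= (fiber c z)%:R :> R by []; nra.
Qed.

Lemma bit_info_ge0 (S Z : finType) (b : S -> bool) (c : S -> Z) :
  (0 < #|S|)%N ->
  0 <= ln 2 + mean_log_fiber (fun w => (b w, c w)) - mean_log_fiber c.
Proof.
move=> S0; have := @gibbs_bit S Z b c (fun _ _ => 1) S0.
rewrite /avg ln1 big1 // mul0r; apply=> // z; lra.
Qed.

(** [E] predicts the bit with advantage [D]; the guess for [gibbs_bit] puts weight 1 + D on the
    predicted value and 1 - D on the other. *)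
Lemma bit_info_ge (S Z : finType) (b : S -> bool) (c : S -> Z) (E : pred Z)
    (D : R) : 0 <= D < 1 -> (0 < #|S|)%N ->
  #|S|%:R * (1 + D) / 2 <= #|[pred w | b w == E (c w)]|%:R ->
  D ^+ 2 / 2 <= ln 2 + mean_log_fiber (fun w => (b w, c w)) - mean_log_fiber c.
Proof.
move=> /andP[D0 D1] S0 hE; have SR0 : 0 < #|S|%:R :> R by rewrite ltr0n.
pose g (b' : bool) z := if b' == E z then 1 + D else 1 - D.
apply: le_trans (gibbs_bit (g := g) b c S0 _ _); last first.
- by move=> z; rewrite /g; case: (E z) => /=; lra.
- by move=> b' z; rewrite /g; case: ifP => _; lra.
rewrite /avg ler_pdivlMr //.
set K := #|_|%:R in hE; have KE : #|[pred w | b w != E (c w)]|%:R = #|S|%:R - K.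
  by rewrite -(cardC [pred w | b w == E (c w)]) natrD addrAC subrr add0r.
have -> : \sum_w ln (g (b w) (c w)) = K * ln (1 + D) + (#|S|%:R - K) * ln (1 - D).
  rewrite (bigID (fun w => b w == E (c w))) /= -KE.
  congr (_ + _).
    rewrite (eq_bigr (fun=> ln (1 + D))) => [|w h]; last by rewrite /g h.
    by rewrite sumr_const mulr_natl.
  rewrite (eq_bigr (fun=> ln (1 - D))) => [|w h]; last by rewrite /g (negbTE h).
  by rewrite sumr_const mulr_natl.
have H := binary_entropy_ge (u := D).
have L : ln (1 - D) <= ln (1 + D) by rewrite ler_ln ?posrE; lra.
have {}H : D ^+ 2 <= _ := H (introT andP (conj D0 D1)).
rewrite -subr_ge0; set lp := ln (1 + D) in L H *; set lm := ln (1 - D) in L H *.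
(* The required difference is the sum of two nonnegative terms: [h1] accounts for successes beyond
   the fraction (1 + D) / 2, and [h2] is the scaled entropy inequality. *)
have h1 : 0 <= (K - #|S|%:R * (1 + D) / 2) * (lp - lm).
  by rewrite mulr_ge0 // subr_ge0.
have h2 : 0 <= #|S|%:R / 2 * ((1 + D) * lp + (1 - D) * lm - D ^+ 2).
  by rewrite mulr_ge0 ?divr_ge0 ?subr_ge0 // ltW.
lra.
Qed.

Lemma bits_info_le (S I Z : finType) (X : S -> {ffun I -> bool}) (c : S -> Z) :
  (0 < #|S|)%N -> (forall x, fiber X x * 2 ^ #|I| <= #|S|)%N ->
  \sum_i (ln 2 + mean_log_fiber (fun w => (X w i, c w)) - mean_log_fiber c)
  <= ln #|Z|%:R.
Proof.
move=> S0 hX; have SR0 : 0 < #|S|%:R :> R by rewrite ltr0n.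
have [w0 _] := card_gt0P S0.
have Z0 : 0 < #|Z|%:R :> R by rewrite ltr0n; apply/card_gt0P; exists (c w0).
pose bc i w := (X w i, c w).
(* The sum of the informations is the mean of [ln G + ln #|Z|], and [ln G <= G - 1]
   where [G] has mean at most 1 since the bits of [X] are uniform. *)
pose G (x : {ffun I -> bool}) z :=
  (\prod_i (2 * ((fiber (bc i) (x i, z))%:R / (fiber c z)%:R))) / #|Z|%:R : R.
have Gpos w i : 0 < 2 * ((fiber (bc i) (X w i, c w))%:R / (fiber c (c w))%:R) :> R.
  by rewrite mulr_gt0 ?divr_gt0 // ?fiberR_gt0 // (fiberR_gt0 (bc i)).
rewrite -(ler_pM2r SR0).
have -> : (\sum_i (ln 2 + mean_log_fiber (bc i) - mean_log_fiber c)) * #|S|%:R =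
    \sum_w (ln (G (X w) (c w)) + ln #|Z|%:R).
  rewrite mulr_suml.
  under eq_bigr => i _.
    rewrite mulrBl mulrDl /mean_log_fiber /avg !divfK ?gt_eqF // mulr_natr.
    rewrite -sumr_const -big_split /= -sumrB.
    over.
  rewrite exchange_big /=; apply: eq_bigr => w _.
  rewrite /G ln_div ?posrE ?prodr_gt0 // subrK ln_prod //.
  apply: eq_bigr => i _; have p1 := fiberR_gt0 c w.
  have p2 := fiberR_gt0 (bc i) w.
  by rewrite lnM ?posrE ?divr_gt0 // ln_div // addrA.
rewrite big_split /= sumr_const -[ln _ *+ _]mulr_natr gerDr.
apply: le_trans (_ : \sum_w (G (X w) (c w) - 1) <= _).
  by apply: ler_sum => w _; apply: ln_le_sub1; rewrite divr_gt0 ?prodr_gt0.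
rewrite sumrB sumr_1 subr_le0.
pose Xc w := (X w, c w); rewrite (sum_comp Xc (fun y => G y.1 y.2)).
rewrite -(pair_bigA _ (fun x z => (fiber Xc (x, z))%:R * G x z)) exchange_big /=.
have G0 x z : 0 <= G x z.
  by rewrite divr_ge0 // prodr_ge0 // => i _; rewrite mulr_ge0 ?divr_ge0.
apply: le_trans (_ : \sum_(z : Z) #|S|%:R / #|Z|%:R <= _); last first.
  by rewrite sumr_const -[leLHS]mulr_natr divfK // gt_eqF.
apply: ler_sum => z _.
(* A joint fibre is bounded by the fibre of [X] alone. Uniformity of the bits makes this weight
   independent of [x], so [G] can be summed over all bit vectors. *)
apply: le_trans (_ : \sum_x #|S|%:R / 2 ^+ #|I| * G x z <= _).
  apply: ler_sum => x _; rewrite ler_wpM2r // ler_pdivlMr ?exprn_gt0 //.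
  rewrite -natrX -natrM ler_nat (leq_trans _ (hX x)) // leq_mul2r.
  apply/orP; right; apply: subset_leq_card; apply/fintype.subsetP => w.
  by rewrite !inE => /eqP [-> _].
rewrite -mulr_sumr /G -mulr_suml.
(* The sum of products factorises by coordinates. Each factor is a conditional law given [z], of
   mass 1, or 0 if the fibre of [z] is empty. *)
have -> : \sum_(x : {ffun I -> bool}) \prod_i
   (2 * ((fiber (bc i) (x i, z))%:R / (fiber c z)%:R)) =
   2 ^+ #|I| * \prod_(i : I) \sum_(b : bool)
     ((fiber (bc i) (b, z))%:R / (fiber c z)%:R) :> R.
  rewrite bigA_distr_bigA mulr_sumr; apply: eq_bigr => x _.
  by rewrite big_split /= prodr_const.
rewrite (_ : _ * _ = #|S|%:R / #|Z|%:R * \prod_i (\sum_b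
  (fiber (bc i) (b, z))%:R / (fiber c z)%:R)); last first.
  by field; rewrite !gt_eqF ?exprn_gt0.
rewrite ler_piMr ?divr_ge0 //; apply: Num.Theory.prodr_ile1 => i _.
rewrite sumr_ge0 //=.
rewrite -mulr_suml big_bool /= -natrD fiber_bit.
by have [->|/eqP f0] := (fiber c z)%:R =P 0 :> R; rewrite ?mul0r ?divff.
Qed.

End Counting.

(** * Averages, probabilities and the second moment method *)

Section Hashing.
Variable R : realType.

Definition Pr (H : finType) (E : pred H) : R := avg (fun h => (E h)%:R).

Lemma avg_le (H : finType) (f g : H -> R) :
  (forall h, f h <= g h) -> avg f <= avg g.
Proof. by move=> fg; rewrite ler_wpM2r ?invr_ge0 // ler_sum. Qed.

Lemma avg_ge0 (H : finType) (f : H -> R) : (forall h, 0 <= f h) -> 0 <= avg f.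
Proof. by move=> f0; rewrite divr_ge0 ?sumr_ge0. Qed.

Lemma avg_sum (H I : finType) (P : pred I) (f : I -> H -> R) :
  avg (fun h => \sum_(i | P i) f i h) = \sum_(i | P i) avg (f i).
Proof. by rewrite /avg exchange_big mulr_suml. Qed.

Lemma avgD (H : finType) (f g : H -> R) :
  avg (fun h => f h + g h) = avg f + avg g.
Proof. by rewrite /avg big_split mulrDl. Qed.

Lemma avgZ (H : finType) a (f : H -> R) : avg (fun h => a * f h) = a * avg f.
Proof. by rewrite /avg -mulr_sumr mulrA. Qed.

Lemma avg_cst (H : finType) (a : R) : (0 < #|H|)%N -> avg (fun _ : H => a) = a.
Proof.
by move=> H0; rewrite /avg sumr_const -[a *+ _]mulr_natr mulfK // pnatr_eq0 -lt0n.
Qed.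

Lemma avg_pair (H1 H2 : finType) (f : H1 * H2 -> R) :
  avg f = avg (fun h1 => avg (fun h2 => f (h1, h2))).
Proof.
rewrite /avg -mulr_suml (eq_bigr (fun h => (fun a b => f (a, b)) h.1 h.2)).
  rewrite -(pair_bigA _ (fun a b => f (a, b))) card_prod natrM invfM mulrA mulrAC; congr (_ * _).
by case.
Qed.

Lemma avg_prod (H1 H2 : finType) (f : H1 -> R) (g : H2 -> R) :
  avg (fun h : H1 * H2 => f h.1 * g h.2) = avg f * avg g.
Proof.
rewrite avg_pair /=; rewrite (_ : (fun h1 => _) = fun h1 => avg g * f h1); first by rewrite avgZ mulrC.
by apply: boolp.funext => h1; rewrite avgZ mulrC.
Qed.

Lemma Pr_card (H : finType) (E : pred H) : Pr E = #|E|%:R / #|H|%:R.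
Proof.
rewrite /Pr /avg; congr (_ / _).
rewrite -sum1_card natr_sum [RHS]big_mkcond /=; apply: eq_bigr => h _.
by rewrite unfold_in; case: (E h).
Qed.

Lemma Pr_le (H : finType) (E F : pred H) :
  (forall h, E h -> F h) -> Pr E <= Pr F.
Proof.
by move=> EF; apply: avg_le => h; rewrite ler_nat; case: (E h) (EF h) => // ->.
Qed.

Lemma Pr_or (H : finType) (E F : pred H) :
  Pr (fun h => E h || F h) <= Pr E + Pr F.
Proof.
rewrite -avgD; apply: avg_le => h; rewrite -natrD ler_nat.
by case: (E h); case: (F h).
Qed.

Lemma Pr_exists (H I : finType) (P : pred I) (E : I -> pred H) :
  Pr (fun h => [exists i, P i && E i h]) <= \sum_(i | P i) Pr (E i).
Proof.
rewrite -avg_sum; apply: avg_le => h.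
case: existsP => [[i /andP[Pi Eih]]|_] /=; last by rewrite sumr_ge0.
by rewrite (bigD1 i) //= Eih lerDl sumr_ge0.
Qed.

(** Chebyshev: the number of accepted elements of [P] has mean [#|P|%:R * p], and where nothing is
    accepted its squared deviation equals the squared mean. The double sum of covariances is the
    variance. *)
Lemma second_moment (H T : finType) (P : pred T) (A : H -> T -> bool) p V :
  (0 < #|H|)%N -> (forall w, P w -> Pr (fun h => A h w) = p) ->
  \sum_(w | P w) \sum_(w' | P w') (Pr (fun h => A h w && A h w') - p ^+ 2) <= V ->
  Pr (fun h => ~~ [exists w, P w && A h w]) * (#|P|%:R * p) ^+ 2 <= V.
Proof.
move=> H0 Ap; apply: le_trans.
set m := #|P|%:R * p.
pose X h : R := \sum_(w | P w) (A h w)%:R.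
have EX : avg X = m.
  by rewrite avg_sum (eq_bigr (fun=> p)) // /m mulr_natl sumr_const.
have EX2 : avg (fun h => X h * X h) =
    \sum_(w | P w) \sum_(w' | P w') Pr (fun h => A h w && A h w').
  rewrite -(eq_bigr _ (fun w _ => avg_sum P _)) -avg_sum.
  congr avg; apply: boolp.funext => h; rewrite mulr_suml.
  apply: eq_bigr => w _; rewrite mulr_sumr; apply: eq_bigr => w' _.
  by case: (A h w); case: (A h w'); rewrite ?mulr0 ?mul0r ?mulr1.
have -> : \sum_(w | P w) \sum_(w' | P w') (Pr (fun h => A h w && A h w') - p ^+ 2)
   = avg (fun h => (X h - m) ^+ 2).
  rewrite (_ : (fun h => (X h - m) ^+ 2) =
      fun h => X h * X h + ((- 2 * m) * X h + m ^+ 2)); last first.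
    by apply: boolp.funext => h; ring.
  rewrite avgD avgD avgZ avg_cst // EX EX2.
  have mm : \sum_(w | P w) \sum_(w' | P w') p ^+ 2 = m ^+ 2.
    by rewrite !sumr_const -mulrnA -[LHS]mulr_natl natrM /m; ring.
  under eq_bigr do rewrite sumrB.
  rewrite sumrB mm; ring.
rewrite mulrC -avgZ; apply: avg_le => h.
have [|/existsPn h0] := boolP [exists w, P w && A h w]; first by rewrite mulr0 sqr_ge0.
rewrite mulr1 /X big1 ?sub0r ?sqrrN // => w Pw.
by move: (h0 w); rewrite Pw /= => /negbTE ->.
Qed.

End Hashing.

(** * Hash tests for fibre sizes *)

Section Protocols.
Variable R : realType.

Record pairwise_indep (H X : finType) (acc : H -> X -> bool) (p : R) : Prop :=
  PairwiseIndep {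
    pi_card : (0 < #|H|)%N;
    pi_gt0 : 0 < p;
    pi_one : forall x, Pr R (fun h => acc h x) = p;
    pi_two : forall x y, x != y -> Pr R (fun h => acc h x && acc h y) = p ^+ 2
  }.

Lemma Pr_pair (H1 H2 : finType) (E1 : pred H1) (E2 : pred H2) :
  Pr R (fun h : H1 * H2 => E1 h.1 && E2 h.2) = Pr R E1 * Pr R E2.
Proof.
rewrite /Pr -avg_prod; congr avg; apply: boolp.funext => h.
by rewrite -natrM; case: (E1 _); case: (E2 _).
Qed.

Lemma eq_Pr (H : finType) (E F : pred H) : E =1 F -> Pr R E = Pr R F.
Proof. by move=> EF; congr Pr; apply: boolp.funext. Qed.

Lemma Pr_ge0 (H : finType) (E : pred H) : 0 <= Pr R E.
Proof. exact: avg_ge0. Qed.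

Lemma sum_eq_fiber (S T : finType) (c : S -> T) (P : pred S) w :
  \sum_(w' | P w') (c w == c w')%:R <= (fiber c (c w))%:R :> R.
Proof.
rewrite /fiber -sum1_card natr_sum [leRHS]big_mkcond [leLHS]big_mkcond /=.
apply: ler_sum => w' _; rewrite inE eq_sym.
by case: (P w'); case: (c w' == c w).
Qed.

Section SmallFibers.
Variables (S Z H1 H2 : finType) (c : S -> Z).
Variables (acc1 : H1 -> Z -> bool) (acc2 : H2 -> S -> bool) (p1 p2 B : R).
Hypotheses (B0 : 0 <= B) (pi1 : pairwise_indep acc1 p1) (pi2 : pairwise_indep acc2 p2).

(** Second moment method on points in small fibres. Two distinct points are correlated only if their
    images agree, which concerns at most [B] partners of each point and gives the first term; the
    diagonal gives the second. *)
Lemma small_fibers_complete :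
  Pr R (fun h : H1 * H2 => ~~ [exists w, acc1 h.1 (c w) && acc2 h.2 w]) *
    #|[pred w | (fiber c (c w))%:R <= B]|%:R <= B / p1 + 1 / (p1 * p2).
Proof.
have [H10 p10 one1 two1] := pi1; have [H20 p20 one2 two2] := pi2.
pose P := [pred w | (fiber c (c w))%:R <= B].
pose A (h : H1 * H2) w := acc1 h.1 (c w) && acc2 h.2 w.
have p0 : 0 < p1 * p2 by rewrite mulr_gt0.
rewrite -[#|_|%:R]/(#|P|%:R); have [->|P0] := posnP #|P|.
  by rewrite mulr0 addr_ge0 ?divr_ge0 // ltW.
have {}P0 : 0 < #|P|%:R :> R by rewrite ltr0n.
have H0 : (0 < #|{: H1 * H2}|)%N by rewrite card_prod muln_gt0 H10 H20.
have two w w' : Pr R (fun h => A h w && A h w') - (p1 * p2) ^+ 2 <=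
    (c w == c w')%:R * (p1 * p2 ^+ 2) + (w == w')%:R * (p1 * p2).
  rewrite (eq_Pr (F := fun h => (acc1 h.1 (c w) && acc1 h.1 (c w'))
      && (acc2 h.2 w && acc2 h.2 w'))); last first.
    by move=> h; rewrite /A andbACA.
  rewrite (Pr_pair (fun h => acc1 h (c w) && acc1 h (c w'))
    (fun h => acc2 h w && acc2 h w')); have [<-|nw] := eqVneq w w'.
    rewrite (eq_Pr (F := fun h => acc1 h (c w))) ?one1; last by move=> h; rewrite andbb.
    rewrite (eq_Pr (F := fun h => acc2 h w)) ?one2; last by move=> h; rewrite andbb.
    rewrite eqxx !mul1r; have := sqr_ge0 (p1 * p2).
    have : 0 <= p1 * p2 ^+ 2 by rewrite mulr_ge0 ?sqr_ge0 ?ltW.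
    lra.
  rewrite two2 //; have [<-|nc] := eqVneq (c w) (c w').
    rewrite (eq_Pr (F := fun h => acc1 h (c w))) ?one1; last by move=> h; rewrite andbb.
    by rewrite mul1r mul0r addr0 gerBl sqr_ge0.
  by rewrite two1 // !mul0r addr0 exprMn subrr.
have hV : Pr R (fun h => ~~ [exists w, P w && A h w]) *
    (#|P|%:R * (p1 * p2)) ^+ 2 <= #|P|%:R * (B * p1 * p2 ^+ 2 + p1 * p2).
  apply: second_moment => // [w _|].
    by rewrite (Pr_pair (acc1^~ (c w)) (acc2^~ w)) one1 one2.
  rewrite mulr_natl -sumr_const; apply: ler_sum => w Pw.
  apply: le_trans (ler_sum _ (fun w' _ => two w w')) _.
  rewrite big_split /= -!mulr_suml; apply: lerD.
    rewrite mulrA ler_wpM2r ?sqr_ge0 // ler_wpM2r ?(ltW p10) //.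
    by rewrite (le_trans (sum_eq_fiber _ _ _)).
  rewrite -[leRHS]mul1r ler_wpM2r ?(ltW p0) //.
  have := sum_eq_fiber id P w; rewrite /fiber (eq_card (B := pred1 w)) ?card1 //.
apply: le_trans (_ : #|P|%:R * (B * p1 * p2 ^+ 2 + p1 * p2) /
    (#|P|%:R * (p1 * p2) ^+ 2) <= _); last first.
  rewrite le_eqVlt; apply/orP; left; apply/eqP; field.
  by rewrite !gt_eqF.
rewrite ler_pdivlMr ?mulr_gt0 ?exprn_gt0 //; apply: le_trans hV.
rewrite [X in _ <= _ * X](_ : _ = #|P|%:R * (#|P|%:R * (p1 * p2) ^+ 2));
  last by ring.
rewrite -[leLHS]mulrA; apply: ler_wpM2r.
  by rewrite mulr_ge0 // mulr_ge0 // sqr_ge0.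
apply: Pr_le => h; apply: contra => /existsP[w /andP[_ Aw]].
by apply/existsP; exists w.
Qed.

Lemma card_large_fibers :
  #|[pred z | B < (fiber c z)%:R]|%:R * B <= #|S|%:R.
Proof.
rewrite -(sum_fiber R c) mulr_natl -sumr_const big_mkcond /=.
by apply: ler_sum => z _; rewrite inE; case: ltP => // /ltW.
Qed.

(** Union bound over two classes. Images with large fibres are few, so for them the first hash alone
    suffices; points in small fibres must pass both hashes. *)
Lemma small_fibers_sound : 0 < B ->
  Pr R (fun h : H1 * H2 => [exists w, acc1 h.1 (c w) && acc2 h.2 w]) <=
  #|S|%:R / B * p1 + #|[pred w | (fiber c (c w))%:R <= B]|%:R * (p1 * p2).
Proof.
move=> Bpos; have [H10 p10 one1 two1] := pi1; have [H20 p20 one2 two2] := pi2.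
apply: le_trans (_ : Pr R (fun h : H1 * H2 =>
   [exists z, (B < (fiber c z)%:R) && acc1 h.1 z] ||
   [exists w, ((fiber c (c w))%:R <= B) && (acc1 h.1 (c w) && acc2 h.2 w)]) <= _).
  apply: Pr_le => h /existsP[w Aw].
  have [wB|wB] := leP (fiber c (c w))%:R B; apply/orP; [right|left].
    by apply/existsP; exists w; rewrite wB.
  by apply/existsP; exists (c w); rewrite wB; case/andP: Aw.
apply: le_trans (Pr_or _ _ _) _; apply: lerD.
  apply: le_trans (Pr_exists _ _ _) _.
  rewrite (eq_bigr (fun=> p1)) => [|z _]; last first.
    have := Pr_pair (acc1^~ z) (fun _ : H2 => true); rewrite one1.
    have -> : Pr R (fun _ : H2 => true) = 1 by rewrite /Pr avg_cst.
    by rewrite mulr1 => <-; apply: eq_Pr => h; rewrite andbT.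
  rewrite sumr_const -[leLHS]mulr_natl ler_wpM2r ?(ltW p10) // ler_pdivlMr //.
  exact: card_large_fibers.
apply: le_trans (Pr_exists _ _ _) _.
rewrite (eq_bigr (fun=> p1 * p2)) => [|w _]; last first.
  by rewrite (Pr_pair (acc1^~ (c w)) (acc2^~ w)) one1 one2.
by rewrite sumr_const -[leLHS]mulr_natl.
Qed.

End SmallFibers.
Section LargeFibers.
Variables (S Z H : finType) (c : S -> Z) (acc : H -> S -> bool) (p B : R).
Hypotheses (B0 : 0 < B) (pi : pairwise_indep acc p).

(** Distinct preimages of [z] have covariance 0, so the variance is at most the mean. *)
Lemma large_fiber_complete z : B <= (fiber c z)%:R ->
  Pr R (fun h => ~~ [exists w, (c w == z) && acc h w]) <= 1 / (B * p).
Proof.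
move=> Bz; have [H0 p0 one two] := pi.
have fz : 0 < (fiber c z)%:R :> R by exact: lt_le_trans Bz.
have := @second_moment R H S (fun w => c w == z) acc p ((fiber c z)%:R * p) H0.
rewrite -[#|_|]/(fiber c z) => hV.
apply: le_trans (_ : (fiber c z)%:R * p / ((fiber c z)%:R * p) ^+ 2 <= _).
  rewrite ler_pdivlMr ?exprn_gt0 ?mulr_gt0 //; apply: hV => //.
  rewrite mulr_natl -sumr_const; apply: ler_sum => w Pw.
  rewrite (bigD1 w) //= big1 ?addr0.
    rewrite (eq_Pr (F := acc^~ w)) ?one ?gerBl ?sqr_ge0 // => h; exact: andbb.
  by move=> w' /andP[_ nw]; rewrite two ?subrr // eq_sym.
rewrite expr2 invfM mulrA divff ?mulf_neq0 ?gt_eqF // !mul1r.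
by rewrite lef_pV2 ?posrE ?mulr_gt0 // ler_wpM2r // ltW.
Qed.

Lemma large_fibers_complete :
  Pr R (fun wh : S * H => ~~ [exists w, (c w == c wh.1) && acc wh.2 w]) <=
  Pr R (fun w => (fiber c (c w))%:R < B) + 1 / (B * p).
Proof.
have [H0 p0 one two] := pi.
rewrite {1}/Pr avg_pair; have [S0|S0] := posnP #|S|.
  by rewrite {1}/avg S0 invr0 mulr0 addr_ge0 ?Pr_ge0 // divr_ge0 // ltW ?mulr_gt0.
rewrite -[1 / _](@avg_cst R S) // -avgD; apply: avg_le => w0.
have [wB|wB] := ltP (fiber c (c w0))%:R B; last first.
  by rewrite add0r; apply: (large_fiber_complete wB).
apply: ler_wpDr; first by rewrite divr_ge0 // ltW ?mulr_gt0.
rewrite -[leRHS](@avg_cst R H 1) //; apply: avg_le => h.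
by rewrite lern1 leq_b1.
Qed.

(** Unless the reference point lies in a large fibre, a union bound over the at most [B] elements of
    its fibre applies. *)
Lemma large_fibers_sound :
  Pr R (fun wh : S * H => [exists w, (c w == c wh.1) && acc wh.2 w]) <=
  Pr R (fun w => B < (fiber c (c w))%:R) + B * p.
Proof.
have [H0 p0 one two] := pi.
rewrite {1}/Pr avg_pair; have [S0|S0] := posnP #|S|.
  by rewrite {1}/avg S0 invr0 mulr0 addr_ge0 ?Pr_ge0 // ltW ?mulr_gt0.
rewrite -[B * p](@avg_cst R S) // -avgD; apply: avg_le => w0.
have [wB|wB] := ltP B (fiber c (c w0))%:R.
  apply: ler_wpDr; first by rewrite ltW ?mulr_gt0.
  rewrite -[leRHS](@avg_cst R H 1) //; apply: avg_le => h.
  by rewrite lern1 leq_b1.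
rewrite add0r; apply: (le_trans (Pr_exists R (fun w => c w == c w0) (fun w h => acc h w))).
rewrite (eq_bigr (fun=> p)) // sumr_const -[leLHS]mulr_natl ler_wpM2r // ltW //.
Qed.

End LargeFibers.
End Protocols.

(** * Concentration of log-fibre sizes in products *)

Section Tails.
Variable R : realType.

(** Chernoff's method. The exponent [l = s / (4 m^2)] minimises - l s + 2 l^2 m^2, and [s <= m]
    keeps [l * m] at most 1/4, within the range of [expR_le_quad]. *)
Lemma upper_tail (S : finType) k (f : S -> R) m s : (0 < #|S|)%N ->
  (forall w, 0 <= f w <= m) -> 0 < m -> 0 < s <= m ->
  Pr R (fun w : {ffun 'I_k -> S} => k%:R * (avg f + s) <= \sum_i f (w i)) <=
  expR (- (k%:R * s ^+ 2 / (8 * m ^+ 2))).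
Proof.
move=> S0 fm m0 /andP[s0 sm]; have SR0 : 0 < #|S|%:R :> R by rewrite ltr0n.
set mu := avg f; pose l := s / (4 * m ^+ 2).
have mu_bound : 0 <= mu <= m.
  rewrite avg_ge0 => [|w]; last by case/andP: (fm w).
  by rewrite -[leRHS](@avg_cst R S m) //; apply: avg_le => w; case/andP: (fm w).
have l0 : 0 < l by rewrite divr_gt0 // mulr_gt0 // exprn_gt0.
have lm : l * m <= 1 / 4.
  rewrite /l (_ : s / (4 * m ^+ 2) * m = s / m / 4); last by field; rewrite gt_eqF.
  have : s / m <= 1 by rewrite ler_pdivrMr ?mul1r.
  lra.
have one : avg (fun w => expR (l * (f w - mu))) <= expR (2 * (l * m) ^+ 2).
  apply: le_trans (_ : avg (fun w => 1 + 2 * (l * m) ^+ 2 + l * (f w - mu)) <= _).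
    apply: avg_le => w; apply: le_trans (expR_le_quad _) _.
      apply: le_trans (_ : l * m <= _); last lra.
      by rewrite ler_pM2l //; have /andP[] := fm w; lra.
    set d := f w - mu; suff : (l * d) ^+ 2 <= (l * m) ^+ 2 by lra.
    rewrite ![(l * _) ^+ 2]exprMn; apply: ler_wpM2l; first exact: sqr_ge0.
    rewrite -[leLHS]real_normK ?num_real //.
    rewrite ler_sqr ?nnegrE ?normr_ge0 ?(ltW m0) // ler_norml /d.
    by have /andP[] := fm w; move/andP: mu_bound => []; lra.
  rewrite avgD avg_cst // avgZ avgD avg_cst // subrr mulr0 addr0.
  exact: expR_ge1Dx.
pose F (w : {ffun 'I_k -> S}) := \prod_i expR (l * (f (w i) - mu)).
apply: le_trans (_ : avg (fun w => expR (- (l * (k%:R * s))) * F w) <= _).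
  apply: avg_le => w; have [h|_] := leP (k%:R * (mu + s)) (\sum_i f (w i)); last first.
    by rewrite mulr_ge0 ?expR_ge0 // prodr_ge0 // => i _; exact: expR_ge0.
  rewrite /F -expR_sum -expRD -[leLHS]expR0 ler_expR -mulr_sumr addrC subr_ge0.
  rewrite ler_pM2l // sumrB sumr_const card_ord -[mu *+ k]mulr_natl; lra.
rewrite avgZ; have -> : avg F = (avg (fun w => expR (l * (f w - mu)))) ^+ k.
  rewrite /avg /F -(bigA_distr_bigA (fun _ w => expR (l * (f w - mu)))) /=.
  by rewrite prodr_const card_ord card_ffun card_ord natrX expr_div_n.
apply: le_trans (_ : expR (- (l * (k%:R * s))) * expR (2 * (l * m) ^+ 2) ^+ k <= _).
  by rewrite ler_wpM2l ?expR_ge0 // lerXn2r ?nnegrE ?expR_ge0 ?avg_ge0 // => w;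
    exact: expR_ge0.
rewrite -expRM_natl -expRD ler_expR le_eqVlt; apply/orP; left; apply/eqP.
by rewrite /l; field; rewrite gt_eqF.
Qed.

Lemma lower_tail (S : finType) k (f : S -> R) m s : (0 < #|S|)%N ->
  (forall w, 0 <= f w <= m) -> 0 < m -> 0 < s <= m ->
  Pr R (fun w : {ffun 'I_k -> S} => \sum_i f (w i) <= k%:R * (avg f - s)) <=
  expR (- (k%:R * s ^+ 2 / (8 * m ^+ 2))).
Proof.
move=> S0 fm m0 sm; apply: le_trans (upper_tail (f := fun w => m - f w) k S0 _ m0 sm).
  apply: Pr_le => w h; rewrite sumrB sumr_const card_ord -[m *+ k]mulr_natl.
  have -> : avg (fun w => m - f w) = m - avg f.
    rewrite (_ : (fun w => m - f w) = (fun w => m + (-1) * f w)).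
      by rewrite avgD avg_cst // avgZ mulN1r.
    by apply: boolp.funext => w'; rewrite mulN1r.
  lra.
by move=> w; have /andP[] := fm w; lra.
Qed.

End Tails.

Definition ffun_power (S T : finType) k (c : S -> T) (w : {ffun 'I_k -> S}) :
  {ffun 'I_k -> T} := [ffun i => c (w i)].

Lemma fiber_power (S T : finType) k (c : S -> T) z :
  fiber (ffun_power (k := k) c) z = (\prod_i fiber c (z i))%N.
Proof.
rewrite /fiber (eq_card (B := family (fun i => [pred w | c w == z i]))).
  by rewrite card_family foldrE big_map big_enum.
move=> w; rewrite !inE; apply/eqP/familyP => [<- i|h].
  by rewrite inE ffunE.
by apply/ffunP => i; rewrite ffunE; apply/eqP; have := h i; rewrite inE.
Qed.

(** The log-fibre size in the product is a sum of [k] independent terms of mean [mean_log_fiber c],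
    which is why it concentrates. *)
Lemma ln_fiber_power (R : realType) (S T : finType) k (c : S -> T) w :
  ln (fiber (ffun_power (k := k) c) (ffun_power c w))%:R =
  \sum_i ln (fiber c (c (w i)))%:R :> R.
Proof.
rewrite fiber_power natr_prod ln_prod => [|i]; last by rewrite ffunE fiberR_gt0.
by apply: eq_bigr => i _; rewrite ffunE.
Qed.

(** * Affine hash functions over the field with two elements *)

Section AffineHash.
Variable R : realType.
Variable Y : finType.

(** Coefficients and constant term of an affine form; thanks to the constant term even the zero
    vector is a zero with probability only 1/2. *)
Definition row : finType := ({ffun Y -> bool} * bool)%type.

Definition row_eval (h : row) (x : {ffun Y -> bool}) : bool :=
  h.2 (+) \big[addb/false]_q (h.1 q && x q).

Definition hash_zero b (h : {ffun 'I_b -> row}) x :=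
  [forall i, ~~ row_eval (h i) x].

Let sg (b : bool) : R := if b then -1 else 1.

(** Makes signs average to 0: flipping the constant term reverses the sign at one point, and
    flipping a coefficient where two points differ reverses the product of their signs. *)
Let avg_antisym (F : row -> R) (tau : row -> row) : involutive tau ->
  (forall h, F (tau h) = - F h) -> avg F = 0.
Proof.
move=> tauK FN; suff : \sum_h F h = 0 by rewrite /avg => ->; rewrite mul0r.
have : \sum_h F h = - \sum_h F h.
  rewrite {1}(reindex_inj (inv_inj tauK)) /= -sumrN.
  by apply: eq_bigr => h _; exact: FN.
lra.
Qed.

Let flip (h : row) : row := (h.1, ~~ h.2).
Let flip_at q0 (h : row) : row := ([ffun q => h.1 q (+) (q == q0)], h.2).

Let flipE h x : row_eval (flip h) x = ~~ row_eval h x.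
Proof. by rewrite /row_eval /= addNb. Qed.

Let flip_atE q0 h x : row_eval (flip_at q0 h) x = row_eval h x (+) x q0.
Proof.
rewrite /row_eval /= -addbA; congr addb.
have -> : x q0 = \big[addb/false]_q ((q == q0) && x q).
  rewrite (bigD1 q0) //= eqxx big1 ?addbF // => q; by move/negbTE => ->.
rewrite -big_split /=; apply: eq_bigr => q _; rewrite ffunE.
by case: (h.1 q); case: (q == q0); case: (x q).
Qed.

Let sgN b : sg (~~ b) = - sg b.
Proof. by case: b; rewrite /sg ?opprK. Qed.

Let row_card_gt0 : (0 < #|row|)%N.
Proof. by apply/card_gt0P; exists ([ffun=> false], false). Qed.

Let row_one x : Pr R (fun h => ~~ row_eval h x) = 2^-1.
Proof.
have s0 : avg (fun h => sg (row_eval h x)) = 0.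
  apply: (@avg_antisym _ flip) => [[h1 h2]|h]; first by rewrite /flip /= negbK.
  by rewrite flipE sgN.
(* The indicator of a zero is (1 + sg) / 2. *)
rewrite /Pr (_ : (fun h => _) = fun h => 2^-1 + 2^-1 * sg (row_eval h x)).
  by rewrite avgD avg_cst // avgZ s0 mulr0 addr0.
by apply: boolp.funext => h; case: (row_eval h x); rewrite /sg /=; lra.
Qed.

Let row_two x y : x != y ->
  Pr R (fun h => ~~ row_eval h x && ~~ row_eval h y) = 2^-1 ^+ 2.
Proof.
move=> xy; have {xy} [q0 xyq] : exists q0, x q0 != y q0.
  apply/existsP; rewrite -negb_forall; apply: contra xy => /forallP h.
  by apply/eqP/ffunP => q; apply/eqP.
have s1 z : avg (fun h => sg (row_eval h z)) = 0.
  apply: (@avg_antisym _ flip) => [[h1 h2]|h]; first by rewrite /flip /= negbK.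
  by rewrite flipE sgN.
have s2 : avg (fun h => sg (row_eval h x) * sg (row_eval h y)) = 0.
  apply: (@avg_antisym _ (flip_at q0)) => [[h1 h2]|h].
    congr pair; apply/ffunP => q; rewrite !ffunE /=.
    by case: (h1 q); case: (q == q0).
  rewrite !flip_atE; move: xyq; case: (x q0); case: (y q0) => //= _;
    by rewrite ?addbT ?addbF sgN ?mulrN ?mulNr.
rewrite /Pr (_ : (fun h => _) = fun h => 2^-1 ^+ 2 + (2^-1 ^+ 2 * sg (row_eval h x)
  + (2^-1 ^+ 2 * sg (row_eval h y)
     + 2^-1 ^+ 2 * (sg (row_eval h x) * sg (row_eval h y))))).
  by rewrite !avgD avg_cst // !avgZ !s1 s2 !mulr0 !addr0.
apply: boolp.funext => h; case: (row_eval h x); case: (row_eval h y);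
  rewrite /sg /=; lra.
Qed.

Let Pr_forall b (E : pred row) :
  Pr R (fun h : {ffun 'I_b -> row} => [forall i, E (h i)]) = Pr R E ^+ b.
Proof.
rewrite /Pr /avg expr_div_n card_ffun card_ord natrX.
have -> : (\sum_x (E x)%:R) ^+ b = \prod_(i < b) \sum_x (E x)%:R :> R.
  by rewrite prodr_const card_ord.
rewrite bigA_distr_bigA /=.
congr (_ / _); apply: eq_bigr => h _; rewrite -natr_prod; congr (_%:R).
have [/forallP Eh|/forallPn [i Eh]] := boolP [forall i, E (h i)].
  by rewrite big1 // => i _; rewrite Eh.
by rewrite (bigD1 i) //= (negbTE Eh) mul0n.
Qed.

Lemma hash_pairwise (X : finType) (code : X -> {ffun Y -> bool}) b :
  injective code ->
  pairwise_indep (fun h x => @hash_zero b h (code x)) (2^-1 ^+ b : R).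
Proof.
move=> codeI; split=> [||x|x y xy].
- by rewrite card_ffun expn_gt0 row_card_gt0.
- by rewrite exprn_gt0 // invr_gt0.
- by rewrite (Pr_forall b (fun h => ~~ row_eval h (code x))) row_one.
rewrite -exprM mulnC exprM -(row_two (x := code x) (y := code y)); last first.
  by rewrite (inj_eq codeI).
rewrite -(Pr_forall b (fun h => ~~ row_eval h (code x) && ~~ row_eval h (code y))).
apply: eq_Pr => h; apply/andP/forallP.
  by move=> [/forallP h1 /forallP h2] i; rewrite h1 h2.
by move=> h1; split; apply/forallP => i; case/andP: (h1 i).
Qed.

End AffineHash.

Definition flatten_ffun k (Y : finType) (w : {ffun 'I_k -> {ffun Y -> bool}}) :
  {ffun 'I_k * Y -> bool} := [ffun p => w p.1 p.2].

Lemma flatten_ffun_inj k Y : injective (@flatten_ffun k Y).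
Proof.
move=> w w' /ffunP E; apply/ffunP => i; apply/ffunP => y.
by have := E (i, y); rewrite !ffunE.
Qed.

(* With [a] about the entropy of the output of the [k]-fold product and [b] about
   its log-fibre size, preimages in small fibres suffice to hit a random zero of
   both hashes, whereas large fibres have too few images for the first hash. *)
Definition small_cert (U O : finType) (c : {ffun U -> bool} -> {ffun O -> bool})
    k a b (h1 : {ffun 'I_a -> row ('I_k * O)%type})
    (h2 : {ffun 'I_b -> row ('I_k * U)%type}) : bool :=
  [exists w, hash_zero h1 (flatten_ffun (ffun_power c w)) &&
             hash_zero h2 (flatten_ffun w)].

(* For a fixed random [w0], the hash on [b] bits has a zero in the fibre of [w0]
   essentially only if that fibre has more than 2^b elements. *)
Definition large_cert (U O : finType) (c : {ffun U -> bool} -> {ffun O -> bool})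
    k b (w0 : {ffun 'I_k -> {ffun U -> bool}})
    (h : {ffun 'I_b -> row ('I_k * U)%type}) : bool :=
  [exists w, (ffun_power c w == ffun_power c w0) && hash_zero h (flatten_ffun w)].

(** * Parameters of the tests and fixing the advice *)

Section Tests.
Variable R : realType.

(** Union bound: a random [h] fails for some input with probability below 1, so one choice serves
    all inputs. *)
Lemma pick_advice (X H : finType) (bad : X -> pred H) (e : R) :
  (0 < #|H|)%N -> (forall v, Pr R (bad v) <= e) -> #|X|%:R * e < 1 ->
  exists h, forall v, ~~ bad v h.
Proof.
move=> H0 bade Xe.
have [/existsP[h /forallP hh]|/existsPn nh] :=
  boolP [exists h, [forall v, ~~ bad v h]]; first by exists h.
suff : 1 <= #|X|%:R * e by rewrite leNgt Xe.
rewrite -[leLHS](@avg_cst R H 1) //.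
apply: le_trans (_ : Pr R (fun h => [exists v, true && bad v h]) <= _).
  apply: avg_le => h; have := nh h; rewrite negb_forall => /existsP[v].
  rewrite negbK => bv; rewrite (_ : [exists v, _] = true) //.
  by apply/existsP; exists v.
apply: le_trans (Pr_exists _ _ _) _.
apply: le_trans (ler_sum _ (fun v _ => bade v)) _.
by rewrite sumr_const -[leLHS]mulr_natl.
Qed.

Lemma expR_ln2 n : expR (n%:R * ln 2) = 2 ^+ n :> R.
Proof. by rewrite expRM_natl lnK // posrE. Qed.

Lemma ln2_le1 : ln 2 <= 1 :> R.
Proof. by apply: le_trans (ln_le_sub1 _) _ => //; lra. Qed.

Lemma ln2_gt0 : 0 < ln 2 :> R.
Proof. by rewrite ln_gt0 // ltr1n. Qed.

Lemma expRN_le (x : R) n : n%:R <= x -> expR (- x) <= (2^-1) ^+ n.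
Proof.
move=> nx; apply: le_trans (_ : expR (- n%:R) <= _).
  by rewrite ler_expR lerN2.
rewrite exprVn expRN lef_pV2 ?posrE ?exprn_gt0 ?expR_gt0 //.
rewrite -[X in expR X]mulr1 expRM_natl lerXn2r ?nnegrE ?expR_ge0 //.
by have := expR_ge1Dx (1 : R); lra.
Qed.

Lemma half_expB a b : (b <= a)%N -> (2^-1) ^+ (a - b) = 2 ^+ b / 2 ^+ a :> R.
Proof.
by move=> ba; rewrite exprVn -[in RHS](subnK ba) exprD; field; rewrite !expf_neq0.
Qed.

(** With K = k g, the n + 5 bits of slack and one bit of rounding cost less than the margin k (g -
    s), since [s] is g / 4. *)
Lemma slack_lt (K : R) n : 128 * (2 * n%:R + 12) <= K ->
  (n + 5).+1%:R * ln 2 < 3 / 4 * K.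
Proof.
move=> hK; apply: le_lt_trans (_ : (n + 5).+1%:R < _).
  by rewrite ler_piMr // ln2_le1.
rewrite -addnS natrD; have : 0 <= n%:R :> R by [].
lra.
Qed.

Lemma natr_slack n : (2 * n + 12)%:R = 2 * n%:R + 12 :> R.
Proof. by rewrite natrD natrM. Qed.

(** [N] is the size of the product domain, [t] and [S] are 2^u and 2^sigma, and [T] counts the
    points in fibres of size at most [B]. The hashes accept with probabilities t / N and S / t, so
    at least S / 2 points of [T] survive on average. *)
Lemma small_complete_numeric (P T N t S B : R) : 0 < N -> 0 < t -> 0 < S ->
  0 <= P -> B * S <= t -> N <= 2 * T ->
  P * T <= B / (t / N) + 1 / ((t / N) * (S / t)) -> P <= 4 / S.
Proof.
move=> N0 t0 S0 P0 BS NT PT.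
have h1 : B / (t / N) <= N / S.
  rewrite invf_div mulrA ler_pdivlMr // mulrAC ler_pdivrMr //.
  by rewrite mulrC mulrA mulrC ler_pM2l // mulrC.
have h2 : 1 / ((t / N) * (S / t)) = N / S by field; rewrite !gt_eqF.
rewrite h2 in PT; rewrite ler_pdivlMr // -(ler_pM2r N0).
have : P * T * S <= 2 * N.
  rewrite -ler_pdivlMr //; apply: le_trans PT _.
  rewrite (_ : 2 * N / S = N / S + N / S) ?lerD2r //; by field; rewrite gt_eqF.
have : P * S * N <= P * S * (2 * T) by rewrite ler_wpM2l // mulr_ge0 // ltW.
lra.
Qed.

(** [L] counts the points in fibres of size at most [B']. The number [d] is both the tail
    probability and the ratio by which the two fibre sizes to be distinguished differ. *)
Lemma small_sound_numeric (L N t S B B' d : R) : 0 < N -> 0 < t -> 0 < S ->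
  0 < B' -> 0 <= d -> B <= B' * d -> t <= B * (2 * S) -> L <= d * N ->
  N / B' * (t / N) + L * ((t / N) * (S / t)) <= 3 * (S * d).
Proof.
move=> N0 t0 S0 B0 d0 BB tB LN.
have -> : N / B' * (t / N) = t / B' by field; rewrite !gt_eqF.
have -> : t / N * (S / t) = S / N by field; rewrite !gt_eqF.
have h1 : t / B' <= 2 * S * d.
  rewrite ler_pdivrMr //; apply: le_trans tB _.
  by rewrite [leRHS](_ : _ = B' * d * (2 * S)); [rewrite ler_pM2r ?mulr_gt0 | ring].
have h2 : L * (S / N) <= d * S.
  by rewrite mulrA ler_pdivrMr // [leRHS]mulrAC ler_pM2r.
lra.
Qed.

Lemma half_of_compl (T T' N : R) : T + T' = N -> T' <= 2^-1 * N -> N <= 2 * T.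
Proof. lra. Qed.

Lemma quarter_half_exp n : 4 / 2 ^+ (n + 5) = (2^-1) ^+ (n + 3) :> R.
Proof.
rewrite exprVn -[(n + 5)%N]/(n + (3 + 2))%N addnA exprD; field.
by rewrite expf_neq0.
Qed.

Section Params.
Variables (X U O : finType) (C : X -> {ffun U -> bool} -> {ffun O -> bool}).
Variables (n k : nat) (g : R).
Hypotheses (Xn : (#|X| <= 2 ^ n)%N) (U0 : (0 < #|U|)%N) (g01 : 0 < g <= 1).
Hypothesis hk : 2 * n%:R + 12 <= k%:R * g ^+ 2 / (128 * #|U|%:R ^+ 2).

Let m : R := #|U|%:R.
Let M := (k * #|U|)%N.
(** Deviation per copy: the thresholds x + s and x + g - s stay g / 2 apart, and k s^2 / (8 m^2)
    becomes the k g^2 / (128 m^2) of [hk]. *)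
Let s := g / 4.
(** Slack in bits: an error of 4 * 2^-(n + 5) survives the union bound over 2^n inputs. *)
Let sigma := (n + 5)%N.
Let q : R := 2^-1.
Let mu v : R := mean_log_fiber R (C v).
Let Omega := {ffun 'I_k -> {ffun U -> bool}}.

Let m_ge1 : 1 <= m. Proof. by rewrite ler1n. Qed.
Let m_gt0 : 0 < m. Proof. by rewrite ltr0n. Qed.
Let g_gt0 : 0 < g. Proof. by case/andP: g01. Qed.
Let g_le1 : g <= 1. Proof. by case/andP: g01. Qed.
Let s_bounds : 0 < s <= m.
Proof. by rewrite /s; apply/andP; split; have := m_ge1; have := g_gt0; have := g_le1; lra. Qed.

Let kg : 128 * (2 * n%:R + 12) <= k%:R * g.
Proof.
have h1 : k%:R * g ^+ 2 / (128 * m ^+ 2) <= k%:R * g / 128.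
  rewrite ler_pdivrMr ?mulr_gt0 ?exprn_gt0 //.
  have -> : k%:R * g / 128 * (128 * m ^+ 2) = k%:R * g * m ^+ 2 by field.
  rewrite expr2 mulrA ler_wpM2l ?mulr_ge0 ?(ltW g_gt0) //.
  by rewrite (le_trans g_le1) // exprn_ege1.
by have := le_trans hk h1; rewrite ler_pdivlMr // mulrC.
Qed.

Let tail_bound : expR (- (k%:R * s ^+ 2 / (8 * m ^+ 2))) <= q ^+ (2 * n + 12).
Proof.
apply: expRN_le; rewrite natr_slack; apply: le_trans hk _.
by rewrite le_eqVlt; apply/orP; left; apply/eqP; rewrite /s; field; rewrite gt_eqF.
Qed.

Let gap_bound : expR (- (k%:R * g / 2)) <= q ^+ (2 * n + 12).
Proof.
apply: expRN_le; rewrite natr_slack; have := kg.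
have : 0 <= n%:R :> R by [].
move: (n%:R : R) (k%:R * g) => N K; lra.
Qed.

Let S_gt0 : (0 < #|{ffun U -> bool}|)%N.
Proof. by rewrite card_ffun expn_gt0 card_bool. Qed.

Let log_fiber_bounds v w : 0 <= ln ((fiber (C v) (C v w))%:R : R) <= m * ln 2.
Proof.
rewrite ln_ge0 ?ler1n ?fiber_gt0 //=.
rewrite -ler_expR expR_ln2 lnK ?posrE ?fiberR_gt0 // -natrX ler_nat.
by rewrite (leq_trans (fiber_leq _ _)) // card_ffun card_bool.
Qed.

Let log_fiber_le v w : 0 <= ln ((fiber (C v) (C v w))%:R : R) <= m.
Proof.
have /andP[-> h] := log_fiber_bounds v w; rewrite (le_trans h) //.
by rewrite ler_piMr // ?ln2_le1 // ltW.
Qed.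

Let mu_ge0 v : 0 <= mu v.
Proof. by apply: avg_ge0 => w; case/andP: (log_fiber_bounds v w). Qed.

Let mu_le v : mu v <= m * ln 2.
Proof.
rewrite -[leRHS](@avg_cst R {ffun U -> bool}) //; apply: avg_le => w.
by case/andP: (log_fiber_bounds v w).
Qed.

Let card_Omega : #|Omega| = (2 ^ M)%N.
Proof. by rewrite !card_ffun card_bool card_ord -expnM mulnC. Qed.

Let Omega_gt0 : (0 < #|Omega|)%N.
Proof. by rewrite card_Omega expn_gt0. Qed.

Let fib v (w : Omega) : R :=
  (fiber (ffun_power (k := k) (C v)) (ffun_power (C v) w))%:R.

Let fib_gt v (z : R) : mu v + s <= z ->
  Pr R (fun w => expR (k%:R * z) < fib v w) <= q ^+ (2 * n + 12).
Proof.
move=> h; apply: le_trans tail_bound.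
apply: le_trans (upper_tail k S_gt0 (log_fiber_le v) m_gt0 s_bounds).
apply: Pr_le => w; rewrite -ln_fiber_power => hw.
rewrite -ler_expR [leRHS]lnK ?posrE ?fiberR_gt0 // (le_trans _ (ltW hw)) //.
by rewrite ler_expR ler_wpM2l.
Qed.

Let fib_le v (z : R) : z <= mu v - s ->
  Pr R (fun w => fib v w <= expR (k%:R * z)) <= q ^+ (2 * n + 12).
Proof.
move=> h; apply: le_trans tail_bound.
apply: le_trans (lower_tail k S_gt0 (log_fiber_le v) m_gt0 s_bounds).
apply: Pr_le => w; rewrite -ln_fiber_power => hw.
rewrite -ler_expR [leLHS]lnK ?posrE ?fiberR_gt0 // (le_trans hw) //.
by rewrite ler_expR ler_wpM2l.
Qed.

Let S_q : 2 ^+ sigma * q ^+ (2 * n + 12) = q ^+ (n + 7).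
Proof.
have -> : (2 * n + 12 = sigma + (n + 7))%N by rewrite mul2n -addnn (addnACA n 5 n 7).
by rewrite exprD mulrA -exprMn divff // expr1n mul1r.
Qed.

Let X_q : #|X|%:R * q ^+ (n + 3) < 1.
Proof.
apply: le_lt_trans (_ : 2 ^+ n * q ^+ (n + 3) < 1).
  apply: ler_wpM2r; first by rewrite exprn_ge0 // invr_ge0.
  by rewrite -natrX ler_nat.
by rewrite exprD mulrA -exprMn divff // expr1n mul1r /q; lra.
Qed.

Let exp_gap x : expR (k%:R * (x + s)) <=
  expR (k%:R * (x + g - s)) * q ^+ (2 * n + 12).
Proof.
have -> : expR (k%:R * (x + s)) = expR (k%:R * (x + g - s)) * expR (- (k%:R * g / 2)).
  by rewrite -expRD; congr expR; rewrite /s; field.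
by apply: ler_wpM2l gap_bound; exact: expR_ge0.
Qed.

Let q_half : q ^+ (2 * n + 12) <= 2^-1.
Proof.
rewrite -[leRHS]expr1; apply: ler_wiXn2l; rewrite ?invr_ge0 ?invf_le1 ?ler1n //.
by rewrite addnS.
Qed.

Let three_q : 3 * q ^+ (n + 7) <= q ^+ (n + 3).
Proof.
rewrite -[(n + 7)%N]/(n + (3 + 4))%N addnA exprD mulrCA ler_piMr //.
  by rewrite exprn_ge0 // invr_ge0.
by rewrite /q; lra.
Qed.

(** 2^u is about 2^sigma e^(k (x + s)), and the hashes have [M - u] and [u - sigma] rows. If most
    fibres have size at most e^(k (x + s)), on the order of 2^sigma points survive both. If mu v >=
    x + g, most fibres exceed e^(k (x + g - s)) and too few images remain for the first hash. *)
Lemma small_fiber_test (x : R) : exists P : X -> Prop,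
  (forall v, (mu v <= x -> P v) /\ (P v -> mu v < x + g)) /\
  ((exists Q, P = fun _ => Q) \/
   exists a b h1 h2, [/\ (a <= M)%N, (b <= M)%N &
     P = fun v => @small_cert U O (C v) k a b h1 h2 : Prop]).
Proof.
(* Mean log-fibre sizes are nonnegative, so nothing has to be accepted. *)
have [x0|x0] := ltP x 0.
  exists (fun=> False); split; last by left; exists False.
  by move=> v; split=> // h; have := le_trans (mu_ge0 v) h; lra.
pose u := ((Num.truncn (k%:R * (x + s) / ln 2)).+1 + sigma)%N.
have kxs0 : 0 <= k%:R * (x + s).
  by rewrite mulr_ge0 // addr_ge0 // ltW //; case/andP: s_bounds.
have u_lo : expR (k%:R * (x + s)) * 2 ^+ sigma <= 2 ^+ u.
  rewrite [2 ^+ u]exprD ler_wpM2r ?exprn_ge0 // -expR_ln2 ler_expR -ler_pdivrMr ?ln2_gt0 //.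
  exact/ltW/truncnS_gt.
have u_hi0 : u%:R * ln 2 <= k%:R * (x + s) + (sigma.+1)%:R * ln 2.
  rewrite /u addSnnS natrD mulrDl lerD2r -ler_pdivlMr ?ln2_gt0 //.
  by rewrite truncn_le divr_ge0 // ltW // ln2_gt0.
have u_hi : 2 ^+ u <= expR (k%:R * (x + s)) * 2 ^+ sigma.+1.
  by rewrite -!expR_ln2 -expRD ler_expR.
(* Here 2^u is at least the size of the domain, which forces mu v < x + g for every [v]. *)
have [Mu|uM] := leqP M u.
  exists (fun=> True); split; last by left; exists True.
  move=> v; split=> // _.
  have h1 : k%:R * mu v <= u%:R * ln 2.
    apply: le_trans (_ : M%:R * ln 2 <= _).
      by rewrite /M natrM -mulrA ler_wpM2l.
    by rewrite ler_wpM2r ?ler_nat // ltW // ln2_gt0.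
  have h2 : k%:R * mu v < k%:R * (x + g).
    apply: le_lt_trans (le_trans h1 u_hi0) _.
    have := slack_lt kg; rewrite (_ : k%:R * (x + g) = k%:R * (x + s) + 3 / 4 * (k%:R * g)).
      by rewrite ltrD2l.
    by rewrite /s; field.
  rewrite -(@ltr_pM2l _ k%:R) // lt_neqAle ler0n andbT eq_sym.
  apply/eqP => k0; move: h2; rewrite k0 !mul0r ltxx //.
have sigma_u : (sigma <= u)%N by rewrite leq_addl.
pose a := (M - u)%N; pose b := (u - sigma)%N.
have p1E : q ^+ a = 2 ^+ u / 2 ^+ M := half_expB (ltnW uM).
have p2E : q ^+ b = 2 ^+ sigma / 2 ^+ u := half_expB sigma_u.
pose H1 : finType := {ffun 'I_a -> row ('I_k * O)%type}.
pose H2 : finType := {ffun 'I_b -> row ('I_k * U)%type}.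
have pi1 := @hash_pairwise R _ _ _ a (@flatten_ffun_inj k O).
have pi2 := @hash_pairwise R _ _ _ b (@flatten_ffun_inj k U).
pose cert v (h : H1 * H2) := small_cert (C v) h.1 h.2.
(* Inputs with mu v strictly between x and x + g may be answered either way. *)
pose bad v (h : H1 * H2) :=
  ((mu v <= x) && ~~ cert v h) || ((x + g <= mu v) && cert v h).
have H0 : (0 < #|{: H1 * H2}|)%N.
  by rewrite card_prod muln_gt0 (pi_card pi1) (pi_card pi2).
have badP v : Pr R (bad v) <= q ^+ (n + 3).
  have [mx|mx] := leP (mu v) x.
    apply: le_trans (_ : Pr R (fun h => ~~ cert v h) <= _).
      apply: Pr_le => h; rewrite /bad => /orP[/andP[]//|/andP[]].
      by move=> h'; have := le_trans h' mx; rewrite gerDl leNgt g_gt0.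
    rewrite /q -quarter_half_exp.
    have := small_fibers_complete (ffun_power (C v)) (expR_ge0 (k%:R * (x + s))) pi1 pi2.
    rewrite p1E p2E; apply: small_complete_numeric; rewrite ?exprn_gt0 ?Pr_ge0 //.
    set T := [pred w | _].
    have : Pr R (predC T) <= 2^-1.
      apply: le_trans (_ : q ^+ (2 * n + 12) <= _); last exact: q_half.
      apply: le_trans (fib_gt (v := v) (z := x + s) _); last by rewrite lerD2r.
      by apply: Pr_le => w /=; rewrite -ltNge.
    rewrite Pr_card card_Omega natrX ler_pdivrMr ?exprn_gt0 // => hT.
    have := cardC T; rewrite card_Omega => /(congr1 (fun i => i%:R : R)).
    by rewrite natrD natrX => /half_of_compl; apply.
  have [xm|xm] := leP (x + g) (mu v); last first.
    have -> : Pr R (bad v) = Pr R (@pred0 (H1 * H2)%type).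
      by apply: eq_Pr => h; rewrite /bad leNgt mx leNgt xm.
    by rewrite Pr_card card0 mul0r exprn_ge0 // invr_ge0.
  apply: le_trans (_ : Pr R (cert v) <= _).
    by apply: Pr_le => h; rewrite /bad leNgt mx /= => /andP[].
  have := small_fibers_sound (ffun_power (C v)) pi1 pi2
    (expR_gt0 (k%:R * (x + g - s))).
  move=> /le_trans; apply; rewrite p1E p2E card_Omega natrX.
  apply: le_trans (small_sound_numeric (B := expR (k%:R * (x + s)))
    (d := q ^+ (2 * n + 12)) _ _ _ _ _ _ _ _) _; rewrite ?exprn_gt0 ?expR_gt0 //.
  - by rewrite exprn_ge0 // invr_ge0.
  - by rewrite -exprS.
  - rewrite -ler_pdivrMr ?exprn_gt0 // -natrX -card_Omega -Pr_card.
    by apply: fib_le; rewrite lerD2r.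
  by rewrite S_q; exact: three_q.
have [[h1 h2] hh] := pick_advice H0 badP X_q.
exists (fun v => cert v (h1, h2)); split; last first.
  right; exists a, b, h1, h2; split=> //; first exact: leq_subr.
  exact: leq_trans (leq_subr _ _) (ltnW uM).
move=> v; have := hh v; rewrite negb_or !negb_and negbK -ltNge -ltNge.
move=> /andP[hx hc]; split=> [mx|cv]; last by move: hc; rewrite cv orbF.
by move: hx; rewrite ltNge mx.
Qed.

Let two_q : q ^+ (2 * n + 12) + 2 ^- sigma <= q ^+ (n + 3).
Proof.
rewrite -exprVn; apply: le_trans (_ : q ^+ sigma + q ^+ sigma <= _).
  rewrite lerD2r; apply: ler_wiXn2l; rewrite ?invr_ge0 ?invf_le1 ?ler1n //.
  by rewrite mul2n -addnn -addnA leq_add2l addnC leq_addr.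
rewrite -[sigma]/(n + (3 + 2))%N addnA exprD -mulrDr ler_piMr //.
  by rewrite exprn_ge0 // invr_ge0.
by rewrite /q; lra.
Qed.

(** With [u] rows, a fibre of size e^(k (y - s)) has on average at least 2^sigma zeros, and one of
    size e^(k (y - g + s)) rarely has any. The reference point need only be typical for every [v],
    so it is fixed as advice together with the hash. *)
Lemma large_fiber_test (y : R) : exists P : X -> Prop,
  (forall v, (y <= mu v -> P v) /\ (P v -> y - g < mu v)) /\
  ((exists Q, P = fun _ => Q) \/
   exists b w0 h, (b <= M)%N /\
     P = fun v => @large_cert U O (C v) k b w0 h : Prop).
Proof.
pose u0 := Num.truncn (k%:R * (y - s) / ln 2).
(* A truncation below [sigma], in particular the 0 assigned to negative numbers, implies y < g, so
   accepting everything is sound. *)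
have [small|large] := ltnP u0 sigma.
  exists (fun=> True); split; last by left; exists True.
  move=> v; split=> // _; apply: lt_le_trans (mu_ge0 v).
  have h1 : k%:R * (y - s) < sigma.+1%:R * ln 2.
    rewrite -ltr_pdivrMr ?ln2_gt0 //.
    apply: lt_le_trans (truncnS_gt _) _; rewrite ler_nat ltnS ltnW //.
  have h2 := lt_trans h1 (slack_lt kg).
  rewrite subr_lt0 ltNge; apply/negP => gy; move: h2; rewrite ltNge => /negP; apply.
  rewrite (_ : 3 / 4 * (k%:R * g) = k%:R * (g - s)); last by rewrite /s; field.
  by rewrite ler_wpM2l // lerD2r.
have kys0 : 0 <= k%:R * (y - s) / ln 2.
  apply: le_trans ler01 _; rewrite -truncn_gt0; apply: leq_trans large.
  by rewrite /sigma addnS.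
pose u := (u0 - sigma)%N.
have u_hi : 2 ^+ u * 2 ^+ sigma <= expR (k%:R * (y - s)).
  rewrite -exprD subnK // -expR_ln2 ler_expR -ler_pdivlMr ?ln2_gt0 //.
  by rewrite truncn_le.
have u_lo : expR (k%:R * (y - s)) <= 2 ^+ u * (2 * 2 ^+ sigma).
  rewrite -exprS -exprD addnS subnK // -expR_ln2 ler_expR -ler_pdivrMr ?ln2_gt0 //.
  exact/ltW/truncnS_gt.
(* Here 2^u exceeds the size of the domain, so y <= mu v never holds. *)
have [Mu|uM] := ltnP M u.
  exists (fun=> False); split; last by left; exists False.
  move=> v; split=> // ymu.
  have h1 : k%:R * (y - s) <= k%:R * (m * ln 2).
    rewrite ler_wpM2l // (le_trans _ (mu_le v)) // (le_trans _ ymu) // gerBl.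
    by case/andP: s_bounds => /ltW.
  have : 2 ^+ u <= 2 ^+ M :> R.
    apply: le_trans (_ : 2 ^+ u * 2 ^+ sigma <= _).
      by rewrite ler_peMr ?exprn_ge0 // exprn_ege1 // ler1n.
    apply: (le_trans u_hi); rewrite -expR_ln2 ler_expR /M natrM -mulrA //.
  by rewrite -!natrX ler_nat leq_exp2l // leqNgt Mu.
pose H : finType := {ffun 'I_u -> row ('I_k * U)%type}.
have pi := @hash_pairwise R _ _ _ u (@flatten_ffun_inj k U).
pose cert v (h : Omega * H) := large_cert (C v) h.1 h.2.
pose bad v (h : Omega * H) :=
  ((y <= mu v) && ~~ cert v h) || ((mu v <= y - g) && cert v h).
have H0 : (0 < #|{: Omega * H}|)%N.
  by rewrite card_prod muln_gt0 Omega_gt0 (pi_card pi).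
have S0 : 0 < 2 ^+ sigma :> R by rewrite exprn_gt0.
have pE : q ^+ u = (2 ^+ u)^-1 by rewrite /q exprVn.
have badP v : Pr R (bad v) <= q ^+ (n + 3).
  have [mx|mx] := leP y (mu v).
    apply: le_trans (_ : Pr R (fun h => ~~ cert v h) <= _).
      apply: Pr_le => h; rewrite /bad => /orP[/andP[]//|/andP[]].
      by move=> h'; have := le_trans mx h'; rewrite lerBrDl gerDr leNgt g_gt0.
    have := large_fibers_complete (ffun_power (C v)) (expR_gt0 (k%:R * (y - s))) pi.
    move=> /le_trans; apply; apply: le_trans two_q; apply: lerD.
      apply: le_trans (fib_le (v := v) (z := y - s) _); last by rewrite lerD2r.
      by apply: Pr_le => w /ltW.
    rewrite div1r lef_pV2 ?posrE ?mulr_gt0 ?expR_gt0 ?exprn_gt0 ?invr_gt0 //.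
    by rewrite pE ler_pdivlMr ?exprn_gt0 // mulrC.
  have [xm|xm] := leP (mu v) (y - g); last first.
    have -> : Pr R (bad v) = Pr R (@pred0 (Omega * H)%type).
      by apply: eq_Pr => h; rewrite /bad leNgt mx leNgt xm.
    by rewrite Pr_card card0 mul0r exprn_ge0 // invr_ge0.
  apply: le_trans (_ : Pr R (cert v) <= _).
    by apply: Pr_le => h; rewrite /bad leNgt mx /= => /andP[].
  pose z := y - g + s.
  have := large_fibers_sound (ffun_power (C v)) (expR_gt0 (k%:R * z)) pi.
  move=> /le_trans; apply.
  apply: le_trans three_q.
  have h1 : Pr R (fun w => expR (k%:R * z) < fib v w) <= q ^+ (n + 7).
    apply: le_trans (fib_gt _) _; first by rewrite /z lerD2r.
    apply: ler_wiXn2l; rewrite ?invr_ge0 ?invf_le1 ?ler1n //.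
    by rewrite mul2n -addnn -addnA leq_add2l addnC leq_addr.
  have h2 : expR (k%:R * z) * q ^+ u <= 2 * q ^+ (n + 7).
    rewrite pE ler_pdivrMr ?exprn_gt0 //; apply: le_trans (exp_gap _) _.
    rewrite (_ : y - g + g - s = y - s); last by rewrite subrK.
    apply: le_trans (_ : 2 ^+ u * (2 * 2 ^+ sigma) * q ^+ (2 * n + 12) <= _).
      by rewrite ler_wpM2r // exprn_ge0 // invr_ge0.
    rewrite -S_q le_eqVlt; apply/orP; left; apply/eqP.
    by move: (2 ^+ u) (2 ^+ sigma) (q ^+ (2 * n + 12)) => a b c; ring.
  apply: le_trans (lerD h1 h2) _.
  by rewrite (_ : 3 * _ = q ^+ (n + 7) + 2 * q ^+ (n + 7)) //; ring.
have [[w0 h] hh] := pick_advice H0 badP X_q.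
exists (fun v => cert v (w0, h)); split; last by right; exists u, w0, h.
move=> v; have := hh v; rewrite negb_or !negb_and negbK -ltNge -ltNge.
move=> /andP[hx hc]; split=> [mx|cv]; last by move: hc; rewrite cv orbF.
by move: hx; rewrite ltNge mx.
Qed.

End Params.
End Tests.

(** * The tests as projections of formulas *)

Section RowForm.
Variables (V : Type) (Y : finType) (r : Y -> V).

(** Linear in the number of variables, since exclusive or is a connective of [form]. *)
Definition row_form (h : row Y) : form V :=
  foldr (fun y f => if h.1 y then FXor (FVar (r y)) f else f) (FConst h.2) (enum Y).

Lemma feval_row_form h e : feval e (row_form h) = row_eval h [ffun y => e (r y)].
Proof.
rewrite /row_form /row_eval -big_enum; elim: (enum Y) => [|y l IH] /=.
  by rewrite big_nil addbF.
rewrite big_cons ffunE addbCA -IH; by case: (h.1 y).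
Qed.

Lemma fsize_row_form h : (fsize (row_form h) <= 2 * #|Y| + 1)%N.
Proof.
rewrite /row_form cardE; elim: (enum Y) => [//|y l IH]; rewrite [foldr _ _ _]/=.
set F := foldr _ _ _ in IH *; rewrite [size _]/=.
by case: (h.1 y); rewrite /=; move: (fsize F) (size l) IH => a b; lia.
Qed.

Lemma nd_hash_zero b (h : {ffun 'I_b -> row Y}) :
  nd (b * (2 * #|Y| + 4)).+1
    (fun e : V -> bool => hash_zero h [ffun y => e (r y)] : Prop).
Proof.
have H : nd (b * (2 * #|Y| + 3).+1).+1 (fun e : V -> bool =>
    forall i, feval e (FNot (row_form (h i))) : Prop).
  apply: nd_forall_ord => i; apply: nd_leq (nd_form _) => /=.
  by rewrite addn1 (addnA _ 1%N 2) addn2 !ltnS fsize_row_form.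
rewrite addnS; apply: nd_ext H => e; split=> [hh|/forallP hh i].
  by apply/forallP => i; have := hh i; rewrite feval_not feval_row_form.
by rewrite feval_not feval_row_form.
Qed.

End RowForm.

(** [s] bounds the projection of the graph, [u] and [o] are the numbers of random and output bits,
    and a hash has at most [k * u] rows. *)
Definition small_size (k s u o : nat) : nat :=
  (k * u + (k * o + ((k * s.+1).+1 +
    (((k * u) * (2 * (k * o) + 4)).+1 +
     ((k * u) * (2 * (k * u) + 4)).+1).+1).+1))%N.

Definition large_size (k s u o : nat) : nat :=
  (k * u + (k * u + (k * o + ((k * s.+1).+1 + ((k * s.+1).+1 +
    (((k * u) * 4).+1 + ((k * u) * (2 * (k * u) + 4)).+1).+1).+1).+1)))%N.

Definition test_size (k s u o : nat) : nat :=
  (small_size k s u o + large_size k s u o).+1.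

Section NdTests.
Variables (n k s : nat) (U O : finType).
Variable C : {ffun 'I_n -> bool} -> {ffun U -> bool} -> {ffun O -> bool}.

(** Projections express relations, so a map enters through its graph and its outputs are guessed
    along with the random bits. *)
Definition graph_env (e : 'I_n + (U + O) -> bool) : Prop :=
  C [ffun i => e (inl i)] [ffun u => e (inr (inl u))] = [ffun x => e (inr (inr x))].

Hypothesis ndC : nd s graph_env.

Let M := (k * #|U|)%N.

Let unflat (Y : finType) (w : 'I_k * Y -> bool) : {ffun 'I_k -> {ffun Y -> bool}} :=
  [ffun i => [ffun y => w (i, y)]].

Let flatten_unflat (Y : finType) (w : 'I_k * Y -> bool) :
  flatten_ffun (unflat w) = [ffun p => w p].
Proof. by apply/ffunP => -[i y]; rewrite !ffunE. Qed.

Let unflatK (Y : finType) (w : {ffun 'I_k -> {ffun Y -> bool}}) :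
  unflat (fun p => w p.1 p.2) = w.
Proof. by apply/ffunP => i; apply/ffunP => y; rewrite !ffunE. Qed.

Let card_k (Y : finType) : #|{: 'I_k * Y}| = (k * #|Y|)%N.
Proof. by rewrite card_prod card_ord. Qed.

Lemma nd_small_cert a b (h1 : {ffun 'I_a -> row ('I_k * O)%type})
    (h2 : {ffun 'I_b -> row ('I_k * U)%type}) : (a <= M)%N -> (b <= M)%N ->
  nd (small_size k s #|U| #|O|) (fun e => small_cert (C [ffun i => e i]) h1 h2 : Prop).
Proof.
move=> aM bM.
pose V := ('I_n + 'I_k * U + 'I_k * O)%type.
pose rC i (x : 'I_n + (U + O)) : V := match x with
  | inl j => inl (inl j) | inr (inl u) => inl (inr (i, u))
  | inr (inr x) => inr (i, x) end.
have H : nd ((k * s.+1).+1 +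
    ((M * (2 * (k * #|O|) + 4)).+1 + (M * (2 * M + 4)).+1).+1).+1
  (fun e : V -> bool => (forall i, graph_env (e \o rC i)) /\
    (hash_zero h1 [ffun p => e (inr p)] : Prop) /\
    (hash_zero h2 [ffun p => e (inl (inr p))] : Prop)).
  apply: nd_and; last apply: nd_and.
  - by apply: nd_forall_ord => i; exact: nd_rename.
  - apply: nd_leq (nd_hash_zero (fun p => inr p : V) h1).
    by rewrite ltnS card_k leq_mul2r aM orbT.
  - apply: nd_leq (nd_hash_zero (fun p => inl (inr p) : V) h2).
    by rewrite ltnS card_k leq_mul2r bM orbT.
have := nd_project (nd_project H); rewrite !card_k; apply: nd_ext => e.
have envE i (w : 'I_k * U -> bool) (z : 'I_k * O -> bool) :
   graph_env (sum_env (sum_env e w) z \o rC i) <->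
   C [ffun i => e i] (unflat w i) = unflat z i.
  rewrite /graph_env /unflat !ffunE.
  by split=> h; exact: h.
split=> [[w [z [hC [hz hw]]]]|/existsP[w /andP[hz hw]]].
  apply/existsP; exists (unflat w); rewrite flatten_unflat.
  have -> : ffun_power (C [ffun i => e i]) (unflat w) = unflat z.
    by apply/ffunP => i; rewrite ffunE; apply/envE.
  by rewrite flatten_unflat hz.
exists (fun p => w p.1 p.2), (fun p => ffun_power (C [ffun i => e i]) w p.1 p.2).
split=> [i|]; first by apply/envE; rewrite !unflatK ffunE.
by rewrite -flatten_unflat !unflatK.
Qed.

(** Although [w0] is fixed, its image depends on the input. A second copy of the random bits is
    pinned to [w0] by literals, and both copies share the guessed output, which expresses equality
    of the images. *)
Lemma nd_large_cert b w0 (h : {ffun 'I_b -> row ('I_k * U)%type}) : (b <= M)%N ->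
  nd (large_size k s #|U| #|O|) (fun e => large_cert (C [ffun i => e i]) w0 h : Prop).
Proof.
move=> bM.
pose V := ('I_n + 'I_k * U + 'I_k * U + 'I_k * O)%type.
pose rC i (x : 'I_n + (U + O)) : V := match x with
  | inl j => inl (inl (inl j)) | inr (inl u) => inl (inl (inr (i, u)))
  | inr (inr x) => inr (i, x) end.
pose rC' i (x : 'I_n + (U + O)) : V := match x with
  | inl j => inl (inl (inl j)) | inr (inl u) => inl (inr (i, u))
  | inr (inr x) => inr (i, x) end.
have H : nd ((k * s.+1).+1 + ((k * s.+1).+1 +
    ((M * 4).+1 + (M * (2 * M + 4)).+1).+1).+1).+1
  (fun e : V -> bool => (forall i, graph_env (e \o rC i)) /\
    (forall i, graph_env (e \o rC' i)) /\
    (forall p, e (inl (inr p)) = w0 p.1 p.2) /\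
    (hash_zero h [ffun p => e (inl (inl (inr p)))] : Prop)).
  apply: nd_and; last apply: nd_and; last apply: nd_and.
  - by apply: nd_forall_ord => i; exact: nd_rename.
  - by apply: nd_forall_ord => i; exact: nd_rename.
  - by rewrite /M -(card_k U); apply: nd_forall => p; exact: nd_lit.
  - apply: nd_leq (nd_hash_zero (fun p => inl (inl (inr p)) : V) h).
    by rewrite ltnS card_k leq_mul2r bM orbT.
have := nd_project (nd_project (nd_project H)); rewrite !card_k; apply: nd_ext => e.
have envE i (w w' : 'I_k * U -> bool) (z : 'I_k * O -> bool) :
   graph_env (sum_env (sum_env (sum_env e w) w') z \o rC i) <->
   C [ffun i => e i] (unflat w i) = unflat z i.
  rewrite /graph_env /unflat !ffunE.
  by split=> hh; exact: hh.
have envE' i (w w' : 'I_k * U -> bool) (z : 'I_k * O -> bool) :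
   graph_env (sum_env (sum_env (sum_env e w) w') z \o rC' i) <->
   C [ffun i => e i] (unflat w' i) = unflat z i.
  rewrite /graph_env /unflat !ffunE.
  by split=> hh; exact: hh.
have powE (w : 'I_k * U -> bool) z :
    (forall i, C [ffun i => e i] (unflat w i) = unflat z i) ->
    ffun_power (C [ffun i => e i]) (unflat w) = unflat z.
  by move=> hh; apply/ffunP => i; rewrite ffunE.
split=> [[w [w' [z [hC [hC' [hw0 hw]]]]]]|/existsP[w /andP[/eqP hz hw]]].
  have w0E : unflat w' = w0.
    by apply/ffunP => i; apply/ffunP => u; rewrite !ffunE; exact: (hw0 (i, u)).
  apply/existsP; exists (unflat w); rewrite flatten_unflat; apply/andP; split=> //.
  rewrite (powE w z) -?w0E ?(powE w' z) // => i; first exact/envE'.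
  exact/envE.
exists (fun p => w p.1 p.2), (fun p => w0 p.1 p.2),
  (fun p => ffun_power (C [ffun i => e i]) w p.1 p.2).
split=> [i|]; first by apply/envE; rewrite !unflatK ffunE.
split=> [i|]; first by apply/envE'; rewrite !unflatK hz ffunE.
by split=> //; rewrite -flatten_unflat !unflatK.
Qed.

Lemma nd_small_test (R : realType) (g x : R) : (0 < #|U|)%N -> 0 < g <= 1 ->
  2 * n%:R + 12 <= k%:R * g ^+ 2 / (128 * #|U|%:R ^+ 2) ->
  exists P : {ffun 'I_n -> bool} -> Prop,
    nd (test_size k s #|U| #|O|) (fun e => P [ffun i => e i]) /\
    forall v, (mean_log_fiber R (C v) <= x -> P v) /\
              (P v -> mean_log_fiber R (C v) < x + g).
Proof.
move=> U0 g01 hk.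
have Xn : (#|{ffun 'I_n -> bool}| <= 2 ^ n)%N by rewrite card_ffun card_bool card_ord.
have [P [specP hP]] := small_fiber_test C Xn U0 g01 hk x.
exists P; split=> //; case: hP => [[Q ->]|[a [b [h1 [h2 [aM bM ->]]]]]].
  by apply: nd_leq (nd_const _ Q).
by apply: nd_leq (nd_small_cert h1 h2 aM bM); rewrite ltnW // ltnS leq_addr.
Qed.

Lemma nd_large_test (R : realType) (g y : R) : (0 < #|U|)%N -> 0 < g <= 1 ->
  2 * n%:R + 12 <= k%:R * g ^+ 2 / (128 * #|U|%:R ^+ 2) ->
  exists P : {ffun 'I_n -> bool} -> Prop,
    nd (test_size k s #|U| #|O|) (fun e => P [ffun i => e i]) /\
    forall v, (y <= mean_log_fiber R (C v) -> P v) /\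
              (P v -> y - g < mean_log_fiber R (C v)).
Proof.
move=> U0 g01 hk.
have Xn : (#|{ffun 'I_n -> bool}| <= 2 ^ n)%N by rewrite card_ffun card_bool card_ord.
have [P [specP hP]] := large_fiber_test C Xn U0 g01 hk y.
exists P; split=> //; case: hP => [[Q ->]|[b [w0 [h [bM ->]]]]].
  by apply: nd_leq (nd_const _ Q).
by apply: nd_leq (nd_large_cert w0 h bM); rewrite ltnW // ltnS leq_addl.
Qed.

End NdTests.

(** * Cores *)

Lemma fiber_inj_comp (S T T' : finType) (f : T -> T') (c : S -> T) w :
  injective f -> fiber (f \o c) (f (c w)) = fiber c (c w).
Proof. by move=> fI; apply: eq_card => w'; rewrite !inE /= (inj_eq fI). Qed.

Lemma mean_log_fiber_inj (R : realType) (S T T' : finType) (f : T -> T')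
    (c : S -> T) : injective f ->
  mean_log_fiber R (f \o c) = mean_log_fiber R c.
Proof.
by move=> fI; congr avg; apply: boolp.funext => w; rewrite fiber_inj_comp.
Qed.

(** * The sampling map and the information of one bit *)

Section Sampling.
Variables (t n o : nat) (A : rcircuit (t * n.+1) o).

Let rho := rbits A.
Let U : finType := ('I_t + 'I_rho)%type.
Let point : finType := {ffun 'I_n -> bool}.

Definition as_tuple (v : {ffun 'I_n -> bool}) : n.-tuple bool := [tuple v q | q < n].

(** The random string holds the selector bits at [inl] and the internal randomness of [A] at
    [inr]. *)
Definition inputs (v0 : point) (b : {ffun 'I_t -> point})
    (w : {ffun 'I_t + 'I_(rbits A) -> bool}) : {set n.-tuple bool} :=
  [set as_tuple (if w (inl j) then b j else v0) | j in 'I_t].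

Definition run (x : {set n.-tuple bool}) (w : {ffun 'I_t + 'I_(rbits A) -> bool}) :
    o.-tuple bool :=
  Defs.eval (rbody A) [tuple of encode_set t x ++ [tuple w (inr j) | j < rbits A]].

Definition sample v0 b w : {ffun 'I_o -> bool} :=
  [ffun x => tnth (run (inputs v0 b w) w) x].

Definition replace (b : {ffun 'I_t -> point}) i v : {ffun 'I_t -> point} :=
  [ffun j => if j == i then v else b j].

Definition sample_at v0 b i (v : {ffun 'I_n -> bool}) w :=
  sample v0 (replace b i v) w.

(** Packs a bit and an output into one bit vector, as the tests require; injectivity preserves all
    fibre sizes. *)
Definition tag_bit (p : bool * {ffun 'I_o -> bool}) : {ffun option 'I_o -> bool} :=
  [ffun x => if x is Some y then p.2 y else p.1].

Lemma tag_bit_inj : injective tag_bit.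
Proof.
move=> [a f] [b g] /ffunP E; have := E None; rewrite !ffunE /= => ->.
by congr pair; apply/ffunP => y; have := E (Some y); rewrite !ffunE.
Qed.

Definition tagged_sample_at v0 b (i : 'I_t) (v : {ffun 'I_n -> bool})
    (w : {ffun 'I_t + 'I_(rbits A) -> bool}) :=
  tag_bit (w (inl i), sample_at v0 b i v w).

Definition sample_size (cs : nat) : nat :=
  (t * n + (t * n.+1 + ((t * n * 12).+1 + (slots_size t n + (15 * cs + 5)).+1).+1))%N.

Definition mux (V : Type) (c : V) (a : bool) (f : form V) : form V :=
  FXor (FConst a) (FAnd (FVar c) (FXor (FConst a) f)).

Lemma feval_mux V c a f (e : V -> bool) :
  feval e (mux c a f) = if e c then feval e f else a.
Proof. by rewrite /=; case: (e c); case: a; case: (feval e f). Qed.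

(** The core is hard-wired and only [v] is input. Guessed are the [t] selected points, as rows of a
    matrix, and the slots encoding their set, on which the circuit of [A] is evaluated. *)
Lemma nd_sample_at v0 b i :
  nd (sample_size (circuit_size (rbody A))) (graph_env (sample_at v0 b i)).
Proof.
pose V0 := ('I_n + (U + 'I_o))%type.
pose V := (V0 + 'I_t * 'I_n + 'I_t * 'I_n.+1)%type.
pose new j q : form V :=
  if j == i then FVar (inl (inl (inl q))) else FConst (b j q).
pose rs (x : 'I_t * 'I_n + 'I_t * 'I_n.+1) : V :=
  match x with inl p => inl (inr p) | inr p => inr p end.
pose rc (x : 'I_(t * n.+1 + rbits A) + 'I_o) : V := match x with
  | inl y => match fintype.split y with
     | inl p => inr (unflat p) | inr j => inl (inl (inr (inl (inr j)))) end
  | inr y => inl (inl (inr (inr y))) end.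
have H : nd ((t * n * 12).+1 +
    (slots_size t n + (15 * circuit_size (rbody A) + 5)).+1).+1
  (fun e : V -> bool =>
    (forall p : 'I_t * 'I_n, feval e (FVar (inl (inr p))) =
       feval e (mux (inl (inl (inr (inl (inl p.1)))))
         (v0 p.2) (new p.1 p.2))) /\
    (slots_ok (matrix_set ((e \o rs) \o inl)) ((e \o rs) \o inr) /\
    Defs.eval (rbody A) [tuple (e \o rc) (inl x) | x < t * n.+1 + rbits A] =
      [tuple (e \o rc) (inr y) | y < o])).
  apply: nd_and; last apply: nd_and.
  - have {1}-> : (t * n)%N = #|{: 'I_t * 'I_n}| by rewrite card_prod !card_ord.
    apply: nd_forall => p; apply: nd_leq (nd_iff_form _ _).
    by rewrite /new; case: ifP.
  - exact: nd_rename (@nd_slots_ok t n).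
  - exact: nd_rename (nd_eval (rbody A)).
have := nd_project (nd_project H); rewrite !card_prod !card_ord.
apply: nd_ext => e.
pose v : point := [ffun q => e (inl q)].
pose w : {ffun U -> bool} := [ffun u => e (inr (inl u))].
pose x0 (p : 'I_t * 'I_n) := (if w (inl p.1) then replace b i v p.1 else v0) p.2.
have inE0 : inputs v0 (replace b i v) w = matrix_set x0.
  apply: eq_imset => j; apply: eq_from_tnth => q.
  by rewrite !tnth_mktuple.
have xE (x : 'I_t * 'I_n -> bool) (s : 'I_t * 'I_n.+1 -> bool) :
  (forall p : 'I_t * 'I_n, feval (sum_env (sum_env e x) s) (FVar (inl (inr p))) =
       feval (sum_env (sum_env e x) s) (mux (inl (inl (inr (inl (inl p.1)))))
         (v0 p.2) (new p.1 p.2))) <-> x = x0.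
  have E p : feval (sum_env (sum_env e x) s) (mux (inl (inl (inr (inl (inl p.1)))))
         (v0 p.2) (new p.1 p.2)) = x0 p.
    rewrite feval_mux /x0 /new /replace /w !ffunE /=; case: (e _) => //.
    by case: (p.1 == i) => //=; rewrite /v ffunE.
  split=> [h|xx0 p]; last by rewrite E -xx0.
  by apply: boolp.funext => p; rewrite -E -h.
have evE (xm : 'I_t * 'I_n -> bool) (s : 'I_t * 'I_n.+1 -> bool) :
   encode_set t (inputs v0 (replace b i v) w) = [tuple s (unflat x) | x < t * n.+1] ->
   (Defs.eval (rbody A) [tuple (sum_env (sum_env e xm) s \o rc) (inl x) | x < t * n.+1 + rbits A] =
      [tuple (sum_env (sum_env e xm) s \o rc) (inr y) | y < o]) <->
   graph_env (sample_at v0 b i) e.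
  move=> encE.
  have -> : [tuple (sum_env (sum_env e xm) s \o rc) (inl x) | x < t * n.+1 + rbits A] =
     [tuple of encode_set t (inputs v0 (replace b i v) w) ++ [tuple w (inr j) | j < rbits A]].
    apply: eq_from_tnth => y; rewrite tnth_mktuple encE /=.
    rewrite (tnth_nth false) /= nth_cat size_tuple.
    case: fintype.splitP => [p yp|j yj].
      by rewrite yp card_ord ltn_ord (nth_map p) ?size_enum_ord // nth_ord_enum.
    rewrite yj card_ord ltnNge leq_addr /= addKn (nth_map j) ?size_enum_ord //.
    by rewrite nth_ord_enum ffunE.
  rewrite /graph_env; split=> [h|/ffunP h].
    apply/ffunP => y; rewrite !ffunE.
    by have := congr1 (fun T => tnth T y) h; rewrite tnth_mktuple => hy; exact: hy.
  apply: eq_from_tnth => y; rewrite tnth_mktuple.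
  by have := h y; rewrite !ffunE => hy; exact: hy.
split=> [[x [s [/xE xx0 [slots ev]]]]|h].
  apply/(evE x s) => //; rewrite inE0 -xx0.
  exact/(slots_okP _ (card_matrix_set x)).
have [s sE] : exists s : 'I_t * 'I_n.+1 -> bool,
    encode_set t (inputs v0 (replace b i v) w) = [tuple s (unflat x) | x < t * n.+1].
  exists (fun p => tnth (encode_set t (inputs v0 (replace b i v) w)) (flat p.1 p.2)).
  by apply: eq_from_tnth => x; rewrite tnth_mktuple unflatK.
exists x0, s; split; first exact/xE.
split; last exact/evE.
by apply/(slots_okP _ (card_matrix_set x0)); rewrite -inE0.
Qed.

Lemma nd_tagged_sample_at v0 b i :
  nd (sample_size (circuit_size (rbody A)) + 6)
    (graph_env (tagged_sample_at v0 b i)).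
Proof.
pose V := ('I_n + (U + option 'I_o))%type.
pose r (x : 'I_n + (U + 'I_o)) : V := match x with
  | inl q => inl q | inr (inl u) => inr (inl u) | inr (inr y) => inr (inr (Some y))
  end.
have := nd_and (nd_rename r (nd_sample_at v0 b i))
  (nd_eq_var (inr (inl (inl i)) : V) (inr (inr None))).
rewrite -addnS; apply: nd_ext => e; rewrite /graph_env /tagged_sample_at.
split=> [[/ffunP h1 h2]|/ffunP h].
  apply/ffunP => -[y|]; rewrite !ffunE //=.
  by have := h1 y; rewrite !ffunE => hy; exact: hy.
split; last by have := h None; rewrite !ffunE.
by apply/ffunP => y; have := h (Some y); rewrite !ffunE => hy; exact: hy.
Qed.

Section Information.
Variable R : realType.

Definition bit_information v0 b i v : R :=
  ln 2 + mean_log_fiber R (tagged_sample_at v0 b i v) -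
  mean_log_fiber R (sample_at v0 b i v).

Lemma bit_informationE v0 b i v : bit_information v0 b i v =
  ln 2 + mean_log_fiber R (fun w : {ffun 'I_t + 'I_(rbits A) -> bool} =>
    (w (inl i), sample_at v0 b i v w)) - mean_log_fiber R (sample_at v0 b i v).
Proof.
congr (_ + _ - _); rewrite -(@mean_log_fiber_inj R _ _ _ tag_bit) //.
exact: tag_bit_inj.
Qed.

Let card_U : #|{ffun U -> bool}| = (2 ^ t * 2 ^ rho)%N.
Proof. by rewrite card_ffun card_bool card_sum !card_ord expnD. Qed.

Lemma bit_information_ge0 v0 b i v : 0 <= bit_information v0 b i v.
Proof. by rewrite bit_informationE; apply: bit_info_ge0; rewrite card_U muln_gt0 !expn_gt0. Qed.

Lemma replace_id (b : {ffun 'I_t -> point}) i : replace b i (b i) = b.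
Proof. by apply/ffunP => j; rewrite ffunE; case: eqP => [->|]. Qed.

(** The sample takes at most 2^o values, and each pattern of selector bits extends in equally many
    ways, so [bits_info_le] applies. *)
Lemma sum_bit_information_le v0 b :
  \sum_i bit_information v0 b i (b i) <= o%:R * ln 2.
Proof.
pose X (w : {ffun U -> bool}) : {ffun 'I_t -> bool} := [ffun i => w (inl i)].
have := @bits_info_le R _ _ _ X (sample v0 b).
have -> : ln #|{ffun 'I_o -> bool}|%:R = o%:R * ln 2 :> R.
  by rewrite card_ffun card_bool card_ord natrX lnXn // mulr_natl.
move=> H.
rewrite (eq_bigr (fun i => ln 2 + mean_log_fiber R (fun w => (X w i, sample v0 b w))
    - mean_log_fiber R (sample v0 b))).
  apply: H => [|x]; first by rewrite card_U muln_gt0 !expn_gt0.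
  rewrite card_ord card_U [leqRHS]mulnC leq_mul2r; apply/orP; right.
  pose Y (w : {ffun U -> bool}) : {ffun 'I_rho -> bool} := [ffun j => w (inr j)].
  rewrite -[leqRHS](_ : #|{ffun 'I_rho -> bool}| = _); last first.
    by rewrite card_ffun card_bool card_ord.
  rewrite /fiber -(@card_in_imset _ _ Y [pred w | X w == x]) ?max_card //.
  move=> w w'; rewrite !inE => /eqP Xw /eqP Xw' /ffunP Yw.
  apply/ffunP => -[j|j]; last by have := Yw j; rewrite !ffunE.
  by move: Xw; rewrite -Xw' => /ffunP /(_ j); rewrite !ffunE.
move=> i _; rewrite bit_informationE /sample_at replace_id.
congr (_ + mean_log_fiber R _ - _).
by apply: boolp.funext => w; rewrite ffunE.
Qed.

(* Swapping [b i] with [v] is an involution of the pairs [(b, v)]. *)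
Lemma sum_replace (N : {set point}) i (f : {ffun 'I_t -> point} -> R) :
  \sum_(b in ffun_on (mem N)) \sum_(v in N) f (replace b i v) =
  #|N|%:R * \sum_(b in ffun_on (mem N)) f b.
Proof.
rewrite pair_big /=.
pose tau (p : {ffun 'I_t -> point} * point) := (replace p.1 i p.2, p.1 i).
have tauK : involutive tau.
  move=> [b v]; rewrite /tau /=; congr pair; last by rewrite ffunE eqxx.
  by apply/ffunP => j; rewrite !ffunE; case: eqP => [->|].
rewrite (reindex_inj (inv_inj tauK)) /=.
rewrite (eq_big (fun p => (p.1 \in ffun_on (mem N)) && (p.2 \in N)) (fun p => f p.1)).
- rewrite -(pair_big (mem (ffun_on (mem N))) (mem N) (fun b v => f b)) /= exchange_big /=.
  by rewrite sumr_const mulr_natl.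
- move=> [b v] /=; apply/andP/andP => [[/ffun_onP h1 h2]|[/ffun_onP h1 h2]].
    split; last by have := h1 i; rewrite ffunE eqxx.
    apply/ffun_onP => j; have [->//|/negbTE ji] := eqVneq j i.
    by have := h1 j; rewrite ffunE ji.
  by split=> //; apply/ffun_onP => j; rewrite ffunE; case: ifP.
move=> [b v] _ /=; congr f; apply/ffunP => j; rewrite !ffunE.
by case: eqP => [->|].
Qed.

(** Averaging over [b] in N^t and the position [i], with [sum_replace] turning the sum over [b] and
    [v] into one bounded by [sum_bit_information_le]. Any element of [N] serves as [v0]. *)
Lemma exists_core (N : {set point}) : (0 < t)%N -> (0 < #|N|)%N ->
  exists v0 (b : {ffun 'I_t -> point}) (i : 'I_t), [/\ v0 \in N, forall j, b j \in N &
    \sum_(v in N) bit_information v0 b i v <= #|N|%:R * (o%:R * ln 2 / t%:R)].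
Proof.
move=> t0 N0; have [v0 v0N] := card_gt0P N0.
set lo := o%:R * ln 2 / t%:R.
suff [b bF [i hi]] : exists2 b : {ffun 'I_t -> point}, b \in ffun_on (mem N) & exists i,
    \sum_(v in N) bit_information v0 b i v <= #|N|%:R * lo.
  by exists v0, b, i; split=> //; apply/ffun_onP.
apply: boolp.contrapT => none.
have big (b : {ffun 'I_t -> point}) i : b \in ffun_on (mem N) -> #|N|%:R * lo < \sum_(v in N) bit_information v0 b i v.
  by move=> bF; rewrite ltNge; apply/negP => h; apply: none; exists b => //; exists i.
have bF : ([ffun=> v0] : {ffun 'I_t -> point}) \in ffun_on (mem N) by apply/ffun_onP => j; rewrite ffunE.
have lt : \sum_(b : {ffun 'I_t -> point} | b \in ffun_on (mem N)) \sum_(i < t) #|N|%:R * lo <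
    \sum_(b in ffun_on (mem N)) \sum_(i < t) \sum_(v in N) bit_information v0 b i v.
  apply: ltr_sum => [|b bF'].
    by apply/hasP; exists [ffun=> v0]; rewrite ?mem_index_enum.
  apply: ltr_sum => [|i _]; last exact: big.
  by apply/hasP; exists (Ordinal t0); rewrite ?mem_index_enum.
move: lt; rewrite ltNge => /negP; apply.
rewrite exchange_big /=.
have -> : \sum_(i < t) \sum_(b in ffun_on (mem N)) \sum_(v in N) bit_information v0 b i v =
  #|N|%:R * \sum_(b in ffun_on (mem N)) \sum_(i < t) bit_information v0 b i (b i).
  rewrite [in RHS]exchange_big mulr_sumr; apply: eq_bigr => i _.
  rewrite -(sum_replace N i (fun b => bit_information v0 b i (b i))).
  apply: eq_bigr => b _; apply: eq_bigr => v _.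
  (* The information depends on [b] and [v] only through [replace b i v], which justifies the
     swap. *)
  rewrite /bit_information /tagged_sample_at /sample_at.
  have -> : replace (replace b i v) i (replace b i v i) = replace b i v.
    exact: replace_id.
  by [].
rewrite mulr_sumr; apply: ler_sum => b _.
apply: le_trans (_ : #|N|%:R * (o%:R * ln 2) <= _).
  by rewrite ler_wpM2l ?sum_bit_information_le.
rewrite sumr_const card_ord -[leRHS]mulr_natl /lo.
by rewrite le_eqVlt; apply/orP; left; apply/eqP; field; rewrite pnatr_eq0 -lt0n.
Qed.

End Information.
End Sampling.

Local Open Scope classical_set_scope.
Local Open Scope ring_scope.

(** * Covering the no-instances by cores *)

Section Cores.
Variable R : realType.
Variables (t n o : nat) (A : rcircuit (t * n.+1) o).
Let point : finType := {ffun 'I_n -> bool}.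
Let core : finType := (point * {ffun 'I_t -> point} * 'I_t)%type.

Definition core_info (c : core) (v : point) : R :=
  bit_information A R c.1.1 c.1.2 c.2 v.

Definition core_in (N : {set point}) (c : core) : Prop :=
  c.1.1 \in N /\ forall j, c.1.2 j \in N.

Lemma exists_good_core (N : {set point}) (theta beta : R) :
  (0 < t)%N -> (0 < #|N|)%N -> 0 < beta ->
  o%:R * ln 2 / t%:R <= theta * beta ->
  exists2 c, core_in N c &
    #|[set v in N | beta < core_info c v]|%:R <= theta * #|N|%:R.
Proof.
move=> t0 N0 beta0 hlo.
have [v0 [b [i [v0N bN hi]]]] := exists_core A R t0 N0.
exists (v0, b, i); first by split.
rewrite -(ler_pM2r beta0); apply: le_trans (_ : #|N|%:R * (o%:R * ln 2 / t%:R) <= _).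
  apply: le_trans hi; rewrite mulr_natl -sumr_const.
  rewrite [leRHS](bigID (fun v => beta < core_info (v0, b, i) v)) /=.
  apply: ler_wpDr; first by apply: sumr_ge0 => v _; exact: bit_information_ge0.
  rewrite (eq_bigl (fun v => (v \in N) && (beta < core_info (v0, b, i) v))).
    by apply: ler_sum => v /andP[_ /ltW].
  by move=> v; rewrite inE.
rewrite [leRHS](_ : _ = #|N|%:R * (theta * beta)); last by ring.
by rewrite ler_wpM2l.
Qed.

Lemma exists_cover (N : {set point}) (theta beta : R) r :
  (0 < t)%N -> 0 < beta -> 0 <= theta ->
  o%:R * ln 2 / t%:R <= theta * beta ->
  exists (cs : seq core) (N' : {set point}),
    [/\ (size cs <= r)%N, forall c, c \in cs -> core_in N c,
        #|N'|%:R <= theta ^+ r * #|N|%:R &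
        forall v, v \in N -> v \in N' \/ exists2 c, c \in cs & core_info c v <= beta].
Proof.
move=> t0 beta0 theta0 hlo; elim: r => [|r [cs [N' [scs csN cN' cov]]]].
  exists [::], N; split=> //; first by rewrite mul1r.
  by move=> v vN; left.
(* [N'] is not known to lie in [N], so the next core is taken inside the intersection; if that is
   empty, [N] is covered already. *)
have [N'0|N'0] := posnP #|N' :&: N|.
  exists cs, finset.set0; split=> //; first exact: leq_trans scs _.
    by rewrite cards0 mulr_ge0 // exprn_ge0.
  move=> v vN; case: (cov v vN) => [vN'|]; last by right.
  by move/eqP: N'0; rewrite cards_eq0 => /eqP/setP/(_ v); rewrite !inE vN' vN.
have [c [c1 c2] hc] := exists_good_core t0 N'0 beta0 hlo.
exists (c :: cs), [set v in N' :&: N | beta < core_info c v]%SET; split=> //.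
- move=> c'; rewrite inE => /predU1P[->|/csN //]; split=> [|j].
    by move: c1; rewrite inE => /andP[].
  by have := c2 j; rewrite inE => /andP[].
- apply: (le_trans hc); rewrite exprS -mulrA ler_wpM2l //.
  apply: le_trans cN'; rewrite ler_nat; apply: subset_leq_card.
  exact: finset.subsetIl.
move=> v vN; case: (cov v vN) => [vN'|[c' c'cs hc']]; last first.
  by right; exists c' => //; rewrite inE c'cs orbT.
have hv : (beta < core_info c v) \/ (core_info c v <= beta).
  by apply/orP; rewrite ltNge orNb.
case: hv => hv.
  by left; rewrite finset.in_set hv andbT; apply/finset.setIP.
by right; exists c; rewrite // in_cons eqxx.
Qed.

Variables (L L' : language) (e_s e_c : R).
Hypothesis sound : forall x : {set n.-tuple bool}, (#|x| <= t)%N ->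
  #|[pred v in x | tval v \in L]| = 0%N ->
  1 - e_s <= prob R A (encode_set t x) (~` L').
Hypothesis complete : forall x : {set n.-tuple bool}, (#|x| <= t)%N ->
  #|[pred v in x | tval v \in L]| = 1%N ->
  1 - e_c <= prob R A (encode_set t x) L'.

Definition no_instances : {set point} :=
  [set v | tval (as_tuple v) \notin L]%SET.

(** No other member of [L] can occur in the input set, and [v] occurs exactly when the selector bit
    [i] is set. Hence membership of the output in [L'] agrees with this bit with probability at
    least the mean of 1 - e_c and 1 - e_s, which is at least (1 + D) / 2. *)
Lemma core_info_yes c v D : 0 <= D < 1 -> D <= 1 - e_s - e_c ->
  core_in no_instances c -> tval (as_tuple v) \in L ->
  D ^+ 2 / 2 <= core_info c v.
Proof.
case: c => -[v0 b] i D01 Dle [/= v0N bN] vL.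
rewrite /core_info /= bit_informationE.
pose E (z : {ffun 'I_o -> bool}) := [tuple z x | x < o] \in [pred y : o.-tuple bool | tval y \in L'].
apply: (bit_info_ge (E := E) D01); first by rewrite card_ffun expn_gt0 card_bool.
set b' := replace b i v.
pose T : finType := {ffun 'I_t -> bool}.
pose P : finType := (rbits A).-tuple bool.
pose join (p : T * P) : {ffun 'I_t + 'I_(rbits A) -> bool} :=
  [ffun u => match u with inl j => p.1 j | inr j => tnth p.2 j end].
pose Xs (x : T) : {set n.-tuple bool} :=
  [set as_tuple (if x j then b' j else v0) | j in 'I_t]%SET.
have cardX x : (#|Xs x| <= t)%N by rewrite (leq_trans (leq_imset_card _ _)) // card_ord.
pose out (x : T) (r : P) : bool :=
  tval (Defs.eval (rbody A) [tuple of encode_set t (Xs x) ++ r]) \in L'.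
have joinE (x : T) (r : P) : (join (x, r) (inl i) == E (sample v0 b' (join (x, r)))) =
   (x i == out x r).
  rewrite ffunE /=; congr (_ == _); rewrite /E inE /out.
  have -> : [tuple (sample v0 b' (join (x, r))) y | y < o] =
      run (inputs v0 b' (join (x, r))) (join (x, r)).
    by apply: eq_from_tnth => y; rewrite tnth_mktuple ffunE.
  have -> : inputs v0 b' (join (x, r)) = Xs x.
    by rewrite /inputs /Xs; apply: eq_imset => j; rewrite ffunE.
  rewrite /run (_ : [tuple join (x, r) (inr j) | j < rbits A] = r) //.
  by apply: eq_from_tnth => j; rewrite tnth_mktuple ffunE.
pose e (c : bool) := 1 - (if c then e_c else e_s).
have fixed (x : T) : e (x i) * 2 ^+ rbits A <= \sum_(r : P) (x i == out x r)%:R.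
  have -> : \sum_(r : P) (x i == out x r)%:R = #|[pred r | x i == out x r]|%:R :> R.
    rewrite -sum1_card natr_sum [RHS]big_mkcond /=.
    by apply: eq_bigr => r _; rewrite inE; case: (_ == _).
  have memX u : u \in Xs x -> tval u \in L -> u = as_tuple v /\ x i.
    move=> /imsetP[j _ ->]; case xj: (x j); last first.
      by move: v0N; rewrite inE => /negP h /h.
    rewrite /b' ffunE; case: eqP => [ji|_] // ; first by rewrite -ji xj.
    by have := bN j; rewrite inE => /negP h /h.
  rewrite /e -ler_pdivlMr ?exprn_gt0 //; case xi: (x i).
    have one : #|[pred u in Xs x | tval u \in L]| = 1%N.
      rewrite -(card1 (as_tuple v)); apply: eq_card => u; rewrite !inE.
      apply/andP/eqP => [[uX uL]|->]; first by have [] := memX u uX uL.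
      split=> //; apply/imsetP; exists i => //.
      by rewrite xi /b' ffunE eqxx.
    apply: le_trans (complete (cardX x) one) _.
    by rewrite /prob ler_pM2r ?invr_gt0 ?exprn_gt0 // ler_nat; apply: subset_leq_card;
      apply/fintype.subsetP => r; rewrite !inE.
  have none : #|[pred u in Xs x | tval u \in L]| = 0%N.
    apply: eq_card0 => u; rewrite !inE; apply/negP => /andP[uX uL].
    by have [_] := memX u uX uL; rewrite xi.
  apply: le_trans (sound (cardX x) none) _.
  rewrite /prob ler_pM2r ?invr_gt0 ?exprn_gt0 // ler_nat; apply: subset_leq_card.
  apply/fintype.subsetP => r; rewrite !inE /out => h'.
  by rewrite eq_sym eqbF_neg; apply/negP; rewrite inE.
have -> : #|[pred w : {ffun 'I_t + 'I_(rbits A) -> bool} | w (inl i) == E (sample_at v0 b i v w)]|%:R =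
   \sum_(x : T) \sum_(r : P) (x i == out x r)%:R :> R.
  under eq_bigr => x _ do under eq_bigr => r _ do rewrite -joinE.
  rewrite (pair_bigA _ (fun x r => (join (x, r) (inl i) ==
     E (sample v0 b' (join (x, r))))%:R)) /=.
  rewrite -sum1_card natr_sum big_mkcond /= (reindex join) /=.
    by apply: eq_bigr => -[x r] _; rewrite inE; case: (_ == _).
  exists (fun w : {ffun 'I_t + 'I_(rbits A) -> bool} => ([ffun j => w (inl j)], [tuple w (inr j) | j < rbits A])).
    move=> [x r] _; congr pair; first by apply/ffunP => j; rewrite !ffunE.
    by apply: eq_from_tnth => j; rewrite tnth_mktuple ffunE.
  by move=> w _; apply/ffunP => -[j|j]; rewrite !ffunE ?tnth_mktuple.
apply: le_trans (ler_sum _ (fun x _ => fixed x)).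
rewrite -mulr_suml.
(* Flipping bit [i] exchanges its two values, so both error bounds get weight 1/2. *)
have -> : \sum_(x : T) e (x i) = 2 ^+ t * (e true + e false) / 2.
  pose flip (x : T) : T := [ffun j => if j == i then ~~ x j else x j].
  have flipK : involutive flip.
    by move=> x; apply/ffunP => j; rewrite !ffunE; case: (j == i); rewrite ?negbK.
  have E1 : \sum_(x : T) e (x i) = \sum_(x : T) e (~~ x i).
    rewrite (reindex_inj (inv_inj flipK)); apply: eq_bigr => x _.
    by rewrite ffunE eqxx.
  have : \sum_(x : T) e (x i) + \sum_(x : T) e (~~ x i) = 2 ^+ t * (e true + e false).
    rewrite -big_split /= (eq_bigr (fun=> e true + e false)) => [|x _].
      by rewrite sumr_const -[LHS]mulr_natl card_ffun card_bool card_ord natrX.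
    by case: (x i); rewrite ?[e false + _]addrC.
  by rewrite -E1; lra.
rewrite card_ffun card_bool card_sum !card_ord expnD natrM !natrX /e.
have T0 : 0 < 2 ^+ t * 2 ^+ rbits A :> R by rewrite mulr_gt0 ?exprn_gt0.
rewrite [leRHS](_ : _ = 2 ^+ t * 2 ^+ rbits A * ((1 - e_c + (1 - e_s)) / 2));
  last by field.
rewrite -mulrA ler_pM2l //; move: Dle; lra.
Qed.

End Cores.

Lemma mean_log_fiber_bounds (R : realType) (U Z : finType)
    (c : {ffun U -> bool} -> Z) : 0 <= mean_log_fiber R c <= #|U|%:R.
Proof.
have S0 : (0 < #|{ffun U -> bool}|)%N by rewrite card_ffun expn_gt0 card_bool.
rewrite avg_ge0 => [|w]; last by rewrite ln_ge0 // ler1n fiber_gt0.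
rewrite -[leRHS](@avg_cst R {ffun U -> bool}) //; apply: avg_le => w.
apply: le_trans (_ : #|U|%:R * ln 2 <= _); last by rewrite ler_piMr // ln2_le1.
rewrite -ler_expR expR_ln2 lnK ?posrE ?fiberR_gt0 // -natrX ler_nat.
by rewrite (leq_trans (fiber_leq _ _)) // card_ffun card_bool.
Qed.

(** * Verifiers for membership and non-membership *)

Definition decision_size (t n o rho cs k J r : nat) : nat :=
  (r * ((J * ((test_size k (sample_size t n cs + 6) (t + rho) o +
               test_size k (sample_size t n cs + 6) (t + rho) o.+1).+1 + 7)).+1
        + 7)).+1.

Section Decision.
Variables (R : realType) (t n o : nat) (A : rcircuit (t * n.+1) o).
Variables (L L' : language) (e_s e_c : R).
Hypothesis sound : forall x : {set n.-tuple bool}, (#|x| <= t)%N ->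
  #|[pred v in x | tval v \in L]| = 0%N ->
  1 - e_s <= prob R A (encode_set t x) (~` L').
Hypothesis complete : forall x : {set n.-tuple bool}, (#|x| <= t)%N ->
  #|[pred v in x | tval v \in L]| = 1%N ->
  1 - e_c <= prob R A (encode_set t x) L'.
Variables (D beta theta g : R) (k J r : nat).
Hypotheses (t_gt0 : (0 < t)%N) (D01 : 0 <= D < 1) (D_le : D <= 1 - e_s - e_c).
Hypotheses (beta_gt0 : 0 < beta) (theta_ge0 : 0 <= theta).
Hypothesis theta_beta : o%:R * ln 2 / t%:R <= theta * beta.
Hypotheses (g01 : 0 < g <= 1) (g_gap : 3 * g <= D ^+ 2 / 2 - beta).
Hypothesis hk : 2 * n%:R + 12 <= k%:R * g ^+ 2 / (128 * (t + rbits A)%:R ^+ 2).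
Hypothesis hJ : (t + rbits A)%:R < J%:R * g.
Hypothesis hr : theta ^+ r * 2 ^+ n < 1.

Let core : finType :=
  ({ffun 'I_n -> bool} * {ffun 'I_t -> {ffun 'I_n -> bool}} * 'I_t)%type.
Let U : finType := ('I_t + 'I_(rbits A))%type.
Let cs := circuit_size (rbody A).
Let muZ (c : core) v : R := mean_log_fiber R (sample_at (A := A) c.1.1 c.1.2 c.2 v).
Let muW (c : core) v : R :=
  mean_log_fiber R (tagged_sample_at (A := A) c.1.1 c.1.2 c.2 v).

Let card_U : #|U| = (t + rbits A)%N.
Proof. by rewrite card_sum !card_ord. Qed.

Let U_gt0 : (0 < #|U|)%N.
Proof. by rewrite card_U addn_gt0 t_gt0. Qed.

Let hkU : 2 * n%:R + 12 <= k%:R * g ^+ 2 / (128 * #|U|%:R ^+ 2).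
Proof. by rewrite card_U. Qed.

(** By [hJ] the grid reaches beyond the number of random bits, which bounds every mean log-fibre
    size. *)
Lemma exists_grid_point c v : exists j : 'I_J,
  j%:R * g <= muZ c v < j%:R * g + g.
Proof.
have /andP[g0 _] := g01.
have /andP[mu0 muU] := mean_log_fiber_bounds R (sample_at (A := A) c.1.1 c.1.2 c.2 v).
rewrite -/(muZ c v) card_U in mu0 muU.
have q0 : 0 <= muZ c v / g by rewrite divr_ge0 // ltW.
have /andP[lo hi] := truncn_itv q0.
have jJ : (Num.truncn (muZ c v / g) < J)%N.
  rewrite truncn_lt_nat // ltr_pdivrMr //; exact: le_lt_trans hJ.
exists (Ordinal jJ); rewrite /= -ler_pdivlMr // lo /=.
by rewrite -[X in _ + X]mul1r -mulrDl natr1 -ltr_pdivrMr.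
Qed.

Let S := (sample_size t n cs + 6)%N.

Let small_Z (c : core) (x : R) :
  exists P : {ffun 'I_n -> bool} -> Prop,
    nd (test_size k S (t + rbits A) o) (fun e => P [ffun i => e i]) /\
    forall v, (muZ c v <= x -> P v) /\ (P v -> muZ c v < x + g).
Proof.
have ndZ := nd_leq (leq_addr 6 _) (nd_sample_at A c.1.1 c.1.2 c.2).
by have := nd_small_test (k := k) ndZ x U_gt0 g01 hkU; rewrite card_U card_ord.
Qed.

Let large_Z (c : core) (x : R) :
  exists P : {ffun 'I_n -> bool} -> Prop,
    nd (test_size k S (t + rbits A) o) (fun e => P [ffun i => e i]) /\
    forall v, (x <= muZ c v -> P v) /\ (P v -> x - g < muZ c v).
Proof.
have ndZ := nd_leq (leq_addr 6 _) (nd_sample_at A c.1.1 c.1.2 c.2).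
by have := nd_large_test (k := k) ndZ x U_gt0 g01 hkU; rewrite card_U card_ord.
Qed.

Let small_W (c : core) (x : R) :
  exists P : {ffun 'I_n -> bool} -> Prop,
    nd (test_size k S (t + rbits A) o.+1) (fun e => P [ffun i => e i]) /\
    forall v, (muW c v <= x -> P v) /\ (P v -> muW c v < x + g).
Proof.
have ndW := nd_tagged_sample_at A c.1.1 c.1.2 c.2.
have := nd_small_test (k := k) ndW x U_gt0 g01 hkU.
by rewrite card_U card_option card_ord.
Qed.

Let large_W (c : core) (x : R) :
  exists P : {ffun 'I_n -> bool} -> Prop,
    nd (test_size k S (t + rbits A) o.+1) (fun e => P [ffun i => e i]) /\
    forall v, (x <= muW c v -> P v) /\ (P v -> x - g < muW c v).
Proof.
have ndW := nd_tagged_sample_at A c.1.1 c.1.2 c.2.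
have := nd_large_test (k := k) ndW x U_gt0 g01 hkU.
by rewrite card_U card_option card_ord.
Qed.

(** By [hr] fewer than one no-instance, hence none, is left after [r] rounds. *)
Let cover : exists cs : seq core, [/\ (size cs <= r)%N,
  forall c, c \in cs -> core_in (no_instances n L) c &
  forall v, tval (as_tuple v) \notin L ->
    exists2 c, c \in cs & core_info R A c v <= beta].
Proof.
have [cl [N' [scl inN cN' cov]]] :=
  @exists_cover R t n o A (no_instances n L) theta beta r t_gt0 beta_gt0 theta_ge0 theta_beta.
exists cl; split=> // v vL.
have [|vN'|//] := cov v; first by rewrite inE.
suff : (#|N'| < 1)%N by rewrite ltnS leqn0 cards_eq0 => /eqP N'0; rewrite N'0 inE in vN'.
rewrite -(ltr_nat R); apply: le_lt_trans hr; apply: (le_trans cN').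
rewrite ler_wpM2l ?exprn_ge0 // -natrX ler_nat.
by rewrite (leq_trans (max_card _)) // card_ffun card_bool card_ord.
Qed.

(** [P] certifies muZ < x + 2 g and [Q] certifies muW > y - g, so the information exceeds D^2 / 2 -
    3 g >= [beta] at every core, which no no-instance achieves. *)
Lemma nd_member : nd (decision_size t n o (rbits A) cs k J r)
  (fun e : 'I_n -> bool => tval (as_tuple [ffun i => e i]) \in L).
Proof.
have [cl [scl inN cov]] := cover; have /andP[g0 g1] := g01.
pose x (j : 'I_J) : R := j%:R * g.
(* A lower bound for [muW] at a yes-instance with muZ >= x j. *)
pose y (j : 'I_J) := x j + D ^+ 2 / 2 - ln 2.
have [P hP] := boolp.choice (fun cj : core * 'I_J => small_Z cj.1 (x cj.2 + g)).
have [Q hQ] := boolp.choice (fun cj : core * 'I_J => large_W cj.1 (y cj.2)).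
have H : nd (decision_size t n o (rbits A) cs k J r) (fun e =>
    forall i : 'I_(size cl), exists j : 'I_J,
      P (tnth (in_tuple cl) i, j) [ffun i => e i] /\
      Q (tnth (in_tuple cl) i, j) [ffun i => e i]).
  apply: nd_leq (nd_forall_ord (fun i => nd_exists_ord (fun j =>
    nd_and (proj1 (hP (tnth (in_tuple cl) i, j)))
           (proj1 (hQ (tnth (in_tuple cl) i, j)))))).
  rewrite ltnS leq_mul // -addn1 leq_add2l //.
apply: nd_ext H => e; set v : {ffun 'I_n -> bool} := [ffun i => e i].
split=> [h|vL i].
  apply/negPn/negP => /cov [c c_cl]; rewrite /core_info /bit_information -/(muZ c v) -/(muW c v).
  have [i ic] : exists i, tnth (in_tuple cl) i = c.
    by have /tnthP[i ->] : c \in in_tuple cl by []; exists i.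
  have [j []] := h i; rewrite ic => pj qj.
  have := (proj2 (hP (c, j)) v).2 pj; have := (proj2 (hQ (c, j)) v).2 qj.
  rewrite /y /= => h1 h2 h3; have := g_gap; lra.
set c := tnth _ i; have c_cl : c \in cl by exact: mem_tnth.
have := core_info_yes sound complete D01 D_le (inN c c_cl) vL.
rewrite /core_info /bit_information -/(muZ c v) -/(muW c v) => info.
have [j /andP[jlo jhi]] := exists_grid_point c v; exists j; split.
  by apply: (proj2 (hP (c, j)) v).1; rewrite /x /= ltW.
by apply: (proj2 (hQ (c, j)) v).1; rewrite /y /x /=; lra.
Qed.

(** The directions are exchanged: muZ > x - g and muW < y + g keep the information below beta + 3 g
    <= D^2 / 2, which no yes-instance allows. *)
Lemma nd_nonmember : nd (decision_size t n o (rbits A) cs k J r)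
  (fun e : 'I_n -> bool => tval (as_tuple [ffun i => e i]) \notin L).
Proof.
have [cl [scl inN cov]] := cover; have /andP[g0 g1] := g01.
pose x (j : 'I_J) : R := j%:R * g.
(* An upper bound for [muW] at a no-instance covered by the core, when muZ < x j + g. *)
pose y (j : 'I_J) := x j + g + beta - ln 2.
have [P hP] := boolp.choice (fun cj : core * 'I_J => large_Z cj.1 (x cj.2)).
have [Q hQ] := boolp.choice (fun cj : core * 'I_J => small_W cj.1 (y cj.2)).
have H : nd (decision_size t n o (rbits A) cs k J r) (fun e =>
    exists i : 'I_(size cl), exists j : 'I_J,
      P (tnth (in_tuple cl) i, j) [ffun i => e i] /\
      Q (tnth (in_tuple cl) i, j) [ffun i => e i]).
  apply: nd_leq (nd_exists_ord (fun i => nd_exists_ord (fun j =>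
    nd_and (proj1 (hP (tnth (in_tuple cl) i, j)))
           (proj1 (hQ (tnth (in_tuple cl) i, j)))))).
  by rewrite ltnS leq_mul.
apply: nd_ext H => e; set v : {ffun 'I_n -> bool} := [ffun i => e i].
split=> [[i [j [pj qj]]]|/cov [c c_cl]].
  apply/negP => vL; set c := tnth _ i in pj qj.
  have c_cl : c \in cl by exact: mem_tnth.
  have := core_info_yes sound complete D01 D_le (inN c c_cl) vL.
  rewrite /core_info /bit_information -/(muZ c v) -/(muW c v).
  have := (proj2 (hP (c, j)) v).2 pj; have := (proj2 (hQ (c, j)) v).2 qj.
  by rewrite /y /= => h1 h2 h3; have := g_gap; lra.
rewrite /core_info /bit_information -/(muZ c v) -/(muW c v) => info.
have [i ic] : exists i, tnth (in_tuple cl) i = c.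
  by have /tnthP[i ->] : c \in in_tuple cl by []; exists i.
have [j /andP[jlo jhi]] := exists_grid_point c v.
exists i, j; rewrite ic; split; first by apply: (proj2 (hP (c, j)) v).1.
by apply: (proj2 (hQ (c, j)) v).1; rewrite /y /x /=; lra.
Qed.

End Decision.

(** * Polynomial bounds and the choice of parameters *)

Section PolyBounded.
Local Open Scope nat_scope.
Implicit Types f g : nat -> nat.

Lemma poly_bounded_leq f g :
  (forall n, f n <= g n) -> poly_bounded g -> poly_bounded f.
Proof. by move=> fg [p hp]; exists p => n; exact: leq_trans (hp n). Qed.

Lemma poly_bounded_cst c : poly_bounded (fun _ => c).
Proof. by exists c%:P => n; rewrite hornerC. Qed.

Lemma poly_bounded_id : poly_bounded (fun n => n).
Proof. by exists 'X => n; rewrite hornerX. Qed.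

Lemma poly_boundedD f g :
  poly_bounded f -> poly_bounded g -> poly_bounded (fun n => f n + g n).
Proof.
by move=> [p hp] [q hq]; exists (p + q)%R => n; rewrite hornerD leq_add.
Qed.

Lemma poly_boundedM f g :
  poly_bounded f -> poly_bounded g -> poly_bounded (fun n => f n * g n).
Proof.
by move=> [p hp] [q hq]; exists (p * q)%R => n; rewrite hornerM leq_mul.
Qed.

Lemma poly_boundedS f : poly_bounded f -> poly_bounded (fun n => (f n).+1).
Proof.
move=> pf; apply: poly_bounded_leq (poly_boundedD pf (poly_bounded_cst 1)) => n.
by rewrite addn1.
Qed.

Lemma poly_bounded_decision_size (t o rho cs k J r : nat -> nat) :
  poly_bounded t -> poly_bounded o -> poly_bounded rho -> poly_bounded cs ->
  poly_bounded k -> poly_bounded J -> poly_bounded r ->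
  poly_bounded (fun n =>
    decision_size (t n) n (o n) (rho n) (cs n) (k n) (J n) (r n)).
Proof.
move=> pt po prho pcs pk pJ pr.
rewrite /decision_size /test_size /small_size /large_size /sample_size.
rewrite /slots_size /row_eq_size /slex_size.
by repeat first [assumption | exact: poly_bounded_id | exact: poly_bounded_cst
  | apply: poly_boundedD | apply: poly_boundedM | apply: poly_boundedS].
Qed.

End PolyBounded.

Lemma NPpoly_of_nd (L : language) (s : nat -> nat) : poly_bounded s ->
  (forall n, nd (s n) (fun e : 'I_n -> bool => L [tuple e q | q < n])) ->
  NPpoly L.
Proof.
move=> ps ndL.
have [w hw] := boolp.choice (fun n => nd_circuit (ndL n)).
pose V n := projT1 (boolp.cid (hw n)).
have hV n := projT2 (boolp.cid (hw n)); rewrite -/(V _) in hV.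
exists w, V; split.
  apply: (poly_bounded_leq (g := fun n => n + 5 * s n + 1)%N).
    by move=> n; have [] := hV n.
  apply: poly_boundedD (poly_bounded_cst 1); apply: poly_boundedD poly_bounded_id _.
  exact: poly_boundedM (poly_bounded_cst 5) ps.
move=> n x; have [_ h] := hV n; rewrite -h.
suff -> : [tuple tnth x q | q < n] = x by [].
by apply: eq_from_tnth => q; rewrite tnth_mktuple.
Qed.

(** Since theta <= e^(theta - 1), it suffices that Q (1 - theta) >= 1. *)
Lemma exists_half_power (R : realType) (theta : R) : 0 <= theta < 1 ->
  exists Q, theta ^+ Q <= 2^-1.
Proof.
move=> /andP[t0 t1]; have d0 : 0 < 1 - theta by rewrite subr_gt0.
exists (Num.truncn (1 / (1 - theta))).+1; set Q := _.+1.
have Q1 : 1 <= Q%:R * (1 - theta).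
  by rewrite -ler_pdivrMr //; exact/ltW/truncnS_gt.
rewrite -[leRHS]expr1; apply: le_trans (expRN_le (n := 1) Q1).
rewrite -mulrN expRM_natl lerXn2r ?nnegrE ?expR_ge0 //.
by have := expR_ge1Dx (- (1 - theta)); lra.
Qed.

Theorem theorem6 (R : realType) (L L' : language) (e_s e_c : R)
  (he_s : 0 <= e_s <= 1) (he_c : 0 <= e_c <= 1)
  (t : nat -> nat) (ht : is_polynomial t) (t_gt0 : forall n, (0 < t n)%N)
  (eps : R) (eps_gt0 : 0 < eps)
  (A : forall n, rcircuit (t n * n.+1) (Num.truncn (eps * (t n)%:R)))
  (A_poly : poly_size A)
  (A_sound : forall (n : nat) (x : {set n.-tuple bool}), (#|x| <= t n)%N ->
     #|[pred v in x | tval v \in L]| = 0%N ->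
     1 - e_s <= prob R (A n) (encode_set (t n) x) (~` L'))
  (A_complete : forall (n : nat) (x : {set n.-tuple bool}), (#|x| <= t n)%N ->
     #|[pred v in x | tval v \in L]| = 1%N ->
     1 - e_c <= prob R (A n) (encode_set (t n) x) L')
  (h : e_s + e_c < 1 - Num.sqrt (2 * ln 2 * eps)) :
  (NPpoly `&` coNPpoly) L.
Proof.
set sq := Num.sqrt _ in h.
have ln2 := ln2_gt0 R.
have sq0 : 0 <= sq by exact: sqrtr_ge0.
have sqE : sq ^+ 2 = 2 * ln 2 * eps by rewrite sqr_sqrtr // !mulr_ge0 // ltW.
(* [D] lies strictly between [sq] and the advantage [Delta]. This keeps D^2 / 2 above ln 2 * eps and
   also [D] below 1, even if [A] never errs. *)
pose Delta := 1 - e_s - e_c; pose D := (sq + Delta) / 2.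
have /andP[es0 _] := he_s; have /andP[ec0 _] := he_c.
have sD : sq < D by rewrite /D /Delta; lra.
have D01 : 0 <= D < 1 by rewrite /D /Delta; apply/andP; split; lra.
have D_le : D <= 1 - e_s - e_c by rewrite /D /Delta; lra.
(* [lo] bounds the average information in nats, and [hi] is what a yes-instance forces. *)
pose lo := ln 2 * eps; pose hi := D ^+ 2 / 2.
have lo0 : 0 < lo by rewrite mulr_gt0.
have lohi : lo < hi.
  have : sq ^+ 2 < D ^+ 2 by rewrite ltr_sqr ?nnegrE //; case/andP: D01.
  by rewrite sqE /lo /hi; lra.
have hi1 : hi < 1.
  have /andP[d0 d1] := D01; rewrite /hi; have : D ^+ 2 <= 1 by rewrite expr_le1 // ltW.
  by lra.
pose beta := (lo + hi) / 2.
have lob : lo < beta by rewrite /beta; lra.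
have bhi : beta < hi by rewrite /beta; lra.
have beta0 : 0 < beta by exact: lt_trans lob.
pose theta := lo / beta.
have th01 : 0 <= theta < 1.
  by rewrite divr_ge0 ?(ltW lo0) ?(ltW beta0) //= ltr_pdivrMr // mul1r.
(* One third of the gap for each of the three losses: the grid and the two tests. *)
pose g := (hi - beta) / 3.
have g0 : 0 < g by rewrite divr_gt0 // subr_gt0.
have g01 : 0 < g <= 1 by rewrite g0 /g; lra.
have g_gap : 3 * g <= D ^+ 2 / 2 - beta by rewrite /g -/hi; lra.
have [Q hQ] := exists_half_power th01.
pose rho n := rbits (A n); pose cs n := circuit_size (rbody (A n)).
pose m n := (t n + rho n)%N.
pose k n := ((Num.truncn (128 / g ^+ 2)).+1 * ((m n * m n) * (2 * n + 12)))%N.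
pose J n := ((Num.truncn (1 / g)).+1 * m n + 1)%N.
(* As theta^Q <= 1/2, the uncovered fraction drops to 2^-(n + 1). *)
pose r n := (Q * (n + 1))%N.
have m0 n : 0 < (m n)%:R :> R by rewrite ltr0n addn_gt0 t_gt0.
have hk n : 2 * n%:R + 12 <= (k n)%:R * g ^+ 2 / (128 * (t n + rbits (A n))%:R ^+ 2).
  rewrite -/(rho n) -/(m n) /k; set K := (Num.truncn _).+1.
  have K1 : 1 <= K%:R * g ^+ 2 / 128.
    rewrite ler_pdivlMr // mul1r -ler_pdivrMr ?exprn_gt0 //; exact/ltW/truncnS_gt.
  rewrite !natrM natr_slack [leRHS](_ : _ = K%:R * g ^+ 2 / 128 * (2 * n%:R + 12)).
    by rewrite ler_peMl // addr_ge0 // mulr_ge0.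
  by field; rewrite gt_eqF.
have hJ n : (t n + rbits (A n))%:R < (J n)%:R * g.
  rewrite -/(rho n) -/(m n) /J; set K := (Num.truncn _).+1.
  have K1 : 1 <= K%:R * g by rewrite -ler_pdivrMr //; exact/ltW/truncnS_gt.
  rewrite natrD natrM mulrDl mul1r mulrAC.
  apply: le_lt_trans (_ : K%:R * g * (m n)%:R < _); last by rewrite ltrDl.
  by rewrite ler_peMl // ltW.
have hr n : theta ^+ r n * 2 ^+ n < 1.
  rewrite /r exprM; apply: le_lt_trans (_ : (2^-1) ^+ (n + 1) * 2 ^+ n < 1).
    rewrite ler_wpM2r ?exprn_ge0 // lerXn2r ?nnegrE ?invr_ge0 //.
    by rewrite exprn_ge0 //; case/andP: th01.
  rewrite exprD mulrAC -exprMn mulVf // expr1n mul1r expr1; lra.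
have th_b n : (Num.truncn (eps * (t n)%:R))%:R * ln 2 / (t n)%:R <= theta * beta.
  rewrite /theta divfK ?gt_eqF // ler_pdivrMr ?ltr0n // /lo -mulrA mulrC ler_pM2l //.
  by rewrite truncn_le mulr_ge0 // ltW.
have pcs : poly_bounded cs by [].
(* Circuit size counts inputs and outputs, hence bounds [t], the random bits and the output
   length. *)
have pt : poly_bounded t.
  apply: poly_bounded_leq pcs => n; rewrite /cs /circuit_size -!addnA.
  by rewrite (leq_trans _ (leq_addr _ _)) // leq_pmulr.
have prho : poly_bounded rho.
  apply: poly_bounded_leq pcs => n; rewrite /cs /circuit_size -!addnA.
  by rewrite (leq_trans _ (leq_addl _ _)) // leq_addr.
have po : poly_bounded (fun n => Num.truncn (eps * (t n)%:R)).
  by apply: poly_bounded_leq pcs => n; rewrite /cs /circuit_size leq_addl.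
have pm : poly_bounded m := poly_boundedD pt prho.
have pk : poly_bounded k.
  apply: poly_boundedM; first exact: poly_bounded_cst.
  apply: poly_boundedM; first exact: poly_boundedM.
  apply: poly_boundedD (poly_bounded_cst 12).
  exact: poly_boundedM (poly_bounded_cst 2) poly_bounded_id.
have pJ : poly_bounded J.
  apply: poly_boundedD (poly_bounded_cst 1).
  exact: poly_boundedM (poly_bounded_cst _) pm.
have pr : poly_bounded r.
  apply: poly_boundedM (poly_bounded_cst _) _.
  exact: poly_boundedD poly_bounded_id (poly_bounded_cst 1).
have psize := poly_bounded_decision_size pt po prho pcs pk pJ pr.
have theta0 : 0 <= theta by case/andP: th01.
have tupleE n (e : 'I_n -> bool) : as_tuple [ffun i => e i] = [tuple e q | q < n].
  by apply: eq_from_tnth => q; rewrite !tnth_mktuple ffunE.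
split; apply: (NPpoly_of_nd psize) => n.
  apply: nd_ext (nd_member (A_sound n) (A_complete n) (t_gt0 n) D01 D_le beta0
    theta0 (th_b n) g01 g_gap (hk n) (hJ n) (hr n)) => e.
  by rewrite tupleE; split=> [/set_mem|/mem_set].
apply: nd_ext (nd_nonmember (A_sound n) (A_complete n) (t_gt0 n) D01 D_le beta0
  theta0 (th_b n) g01 g_gap (hk n) (hJ n) (hr n)) => e.
rewrite tupleE; split=> [/negP hL eL|hL]; first by apply: hL; exact/mem_set.
by apply/negP => /set_mem.
Qed.
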